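(* Let $J$ be a bounded Jacobi matrix with $a_j>0$ and $b_j\in\mathbb{C}$ for all $j\ge 0$, and let $\nu$ be the spectral measure of $|J|$ corresponding to $\delta_0$. There exists a unique function $\psi\in L^\infty(\nu)$ with $\psi(0)=1$ such that $|\psi(s)|\le 1$ for $\nu$-a.e. $s\ge0$ and $$\langle Jf(|J|)\delta_0,\delta_0\rangle=\int_0^\infty s f(s)\psi(s)\,\mathrm{d}\nu(s)\qquad\text{for all } f\in C(\mathbb{R}).$$
   Context: Let $\delta_j$, $j\ge0$, be the standard basis of $\ell^2(\mathbb{N}_0)$, $\mathbb{N}_0=\{0,1,2,\dots\}$, and let $\langle\cdot,\cdot\rangle$ be the inner product of $\ell^2(\mathbb{N}_0)$, linear in the first argument. A Jacobi matrix with parameters $(a_j)_{j\ge0}$, $(b_j)_{j\ge0}$ is the infinite tridiagonal symmetric matrix $J$ with $J_{j,j}=b_j$, $J_{j,j+1}=J_{j+1,j}=a_j$ and all other entries zero. It is bounded if $\sup_{j\ge0}(|a_j|+|b_j|)<\infty$; it is then regarded as a bounded linear operator on $\ell^2(\mathbb{N}_0)$. We write $|J|=\sqrt{J^*J}$. The measure $\nu$ is the Borel probability measure $\nu(\Delta)=\langle\chi_\Delta(|J|)\delta_0,\delta_0\rangle$, supported in a bounded subset of $[0,\infty)$. Uniqueness is as an element of $L^\infty(\nu)$; the condition $\psi(0)=1$ is only a normalisation, which matters only if $\nu(\{0\})>0$. *)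

(* Defs.v *)
From HB Require Import structures.
From mathcomp Require Import all_boot all_order all_algebra.
From mathcomp Require Import complex zify ring lra.
From mathcomp Require Import all_classical all_reals all_analysis.

Set Implicit Arguments.
Unset Strict Implicit.
Unset Printing Implicit Defensive.

Import Order.TTheory GRing.Theory Num.Theory.
Import numFieldNormedType.Exports.

Local Open Scope classical_set_scope.
Local Open Scope complex_scope.
Local Open Scope ring_scope.

Notation cRe := complex.Re.
Notation cIm := complex.Im.
Notation cmod := Normc.normc.

Section square_summable.
Context {R : realType}.
Implicit Types (u v : nat -> R[i]^o) (z : R[i]).

Definition square_summable u : Prop :=
  cvgn (series (fun k => cmod (u k) ^+ 2)).

Lemma cmod_ge0 z : 0 <= cmod z.
Proof. by case: z => x y; exact: sqrtr_ge0. Qed.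

Lemma sqr_cmod z : cmod z ^+ 2 = cRe z ^+ 2 + cIm z ^+ 2.
Proof. by case: z => x y; rewrite sqr_sqrtr// addr_ge0// sqr_ge0. Qed.

Lemma cmodD2 (x y : R[i]) :
  cmod (x + y) ^+ 2 <= 2 * (cmod x ^+ 2 + cmod y ^+ 2).
Proof.
rewrite !sqr_cmod; case: x y => [a b] [c d] /=.
by have := sqr_ge0 (a - c); have := sqr_ge0 (b - d); nra.
Qed.

Lemma cmodD3 (x y z : R[i]) :
  cmod (x + y + z) ^+ 2 <= 3 * (cmod x ^+ 2 + cmod y ^+ 2 + cmod z ^+ 2).
Proof.
rewrite !sqr_cmod; case: x y z => [a b] [c d] [e f] /=.
have := sqr_ge0 (a - c); have := sqr_ge0 (b - d).
have := sqr_ge0 (a - e); have := sqr_ge0 (b - f).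
by have := sqr_ge0 (c - e); have := sqr_ge0 (d - f); nra.
Qed.

Lemma series_sqr_nondecreasing u :
  nondecreasing_seq (series (fun k => cmod (u k) ^+ 2)).
Proof. by apply/nondecreasing_series => n _ _; exact: sqr_ge0. Qed.

Lemma square_summableP u :
  square_summable u <->
  exists M : R, forall n, \sum_(k < n) cmod (u k) ^+ 2 <= M.
Proof.
split=> [cu|[M uM]].
  exists (limn (series (fun k => cmod (u k) ^+ 2))) => n.
  have := nondecreasing_cvgn_le (@series_sqr_nondecreasing u) cu n.
  by rewrite /series /= big_mkord.
apply: nondecreasing_is_cvgn; first exact: series_sqr_nondecreasing.
by exists M => _ [n _ <-]; rewrite /series /= big_mkord.
Qed.

Definition ell2_pred : {pred nat -> R[i]^o} :=
  [pred u : nat -> R[i]^o | `[< square_summable u >]].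

Lemma ell2_submod_closed : submod_closed ell2_pred.
Proof.
split=> [|c u v].
  rewrite inE; apply/square_summableP; exists 0 => n.
  by rewrite big1// => k _; rewrite Normc.normc0 expr0n.
rewrite !inE => /square_summableP[M uM] /square_summableP[N vN].
apply/square_summableP.
exists (2 * (cmod c ^+ 2 * M + N)) => n.
apply: (@le_trans _ _ (\sum_(k < n)
    2 * (cmod c ^+ 2 * cmod (u k) ^+ 2 + cmod (v k) ^+ 2))).
  apply: ler_sum => k _; rewrite -exprMn -Normc.normcM.
  exact: cmodD2.
rewrite -mulr_sumr big_split/= -mulr_sumr ler_wpM2l//; apply: lerD.
- by apply: ler_wpM2l; [exact: sqr_ge0|exact: uM].
- exact: vN.
Qed.

HB.instance Definition _ :=
  GRing.isSubmodClosed.Build _ _ ell2_pred ell2_submod_closed.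

End square_summable.

Record ell2 (R : realType) := Ell2 {
  ell2_val :> nat -> R[i]^o ;
  ell2_valP : ell2_val \in @ell2_pred R }.

Section ell2_theory.
Context {R : realType}.

HB.instance Definition _ := [isSub for @ell2_val R].
HB.instance Definition _ := [Choice of ell2 R by <:].
HB.instance Definition _ := [SubChoice_isSubLmodule of ell2 R by <:].

Implicit Types u v : ell2 R.

Definition inner u v : R[i] :=
  limn (series (fun k => cRe (u k * (v k)^*))) +i*
  limn (series (fun k => cIm (u k * (v k)^*))).

Definition ell2_norm u : R := Num.sqrt (cRe (inner u u)).

Lemma inner0l v : inner 0 v = 0.
Proof.
have h (g : R[i] -> R) : g 0 = 0 ->
    limn (series (fun k => g ((0 : ell2 R) k * (v k)^*))) = 0.
  move=> g0; rewrite [X in limn X](_ : _ = cst 0) ?lim_cst//.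
  by apply/funext => n; rewrite /series/= big1// => k _; rewrite mul0r.
by rewrite /inner !h.
Qed.

Lemma inner_ge0 u : 0 <= cRe (inner u u).
Proof.
have ru k : cRe (u k * (u k)^*) = cmod (u k) ^+ 2.
  rewrite sqr_cmod; case: (u k) => x y /=; ring.
rewrite /= (eq_fun ru).
have /asboolP cu : `[< square_summable u >] by have := ell2_valP u; rewrite inE.
apply: limr_ge => //; near=> n.
by apply: sumr_ge0 => k _; exact: sqr_ge0.
Unshelve. all: by end_near. Qed.

Lemma delta_subproof (j : nat) : (fun k => (k == j)%:R) \in @ell2_pred R.
Proof.
rewrite inE; apply/square_summableP; exists 1 => n.
have [jn|nj] := ltnP j n; last first.
  rewrite big1 ?ler01// => k _.
  by rewrite (ltn_eqF (leq_trans (ltn_ord k) nj)) Normc.normc0 expr0n.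
rewrite (bigD1 (Ordinal jn))//= eqxx Normc.normc1 expr1n big1 ?addr0// => k kj.
by rewrite (negbTE kj : (k == j :> nat) = false) Normc.normc0 expr0n.
Qed.

Definition delta (j : nat) : ell2 R := Ell2 (delta_subproof j).

End ell2_theory.

Section jacobi.
Context {R : realType} (a : nat -> R) (b : nat -> R[i]).

Definition jacobi_mx (i j : nat) : R[i] :=
  if i == j then b i
  else if j == i.+1 then (a i)%:C
  else if i == j.+1 then (a j)%:C
  else 0.

(* Row i of the matrix vanishes beyond column i.+1. *)
Definition jacobi_act (u : nat -> R[i]^o) : nat -> R[i]^o :=
  fun i => \sum_(k < i.+2) jacobi_mx i k * u k.

Definition bounded_jacobi : Prop :=
  exists M : R, forall j, `|a j| + cmod (b j) <= M.

Lemma cmod_jacobi_mx (M : R) i k : (forall j, `|a j| + cmod (b j) <= M) ->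
  cmod (jacobi_mx i k) ^+ 2 <= M ^+ 2.
Proof.
move=> abM.
have aM j : cmod (a j)%:C <= M.
  rewrite /= expr0n addr0 sqrtr_sqr; apply: le_trans (abM j).
  by rewrite lerDl cmod_ge0.
have bM j : cmod (b j) <= M by apply: le_trans (abM j); rewrite lerDr.
have M0 : 0 <= M := le_trans (cmod_ge0 _) (bM 0).
rewrite ler_sqr ?nnegrE ?cmod_ge0// /jacobi_mx.
by do 3 (case: ifP => // _); rewrite Normc.normc0.
Qed.

Lemma cmod_jacobi_act (M : R) (u : nat -> R[i]^o) i :
  (forall j, `|a j| + cmod (b j) <= M) ->
  cmod (jacobi_act u i) ^+ 2 <=
  3 * M ^+ 2 * (cmod (u i.-1) ^+ 2 + cmod (u i) ^+ 2 + cmod (u i.+1) ^+ 2).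
Proof.
move=> abM.
have JM k : cmod (jacobi_mx i k * u k) ^+ 2 <= M ^+ 2 * cmod (u k) ^+ 2.
  rewrite Normc.normcM exprMn ler_wpM2r ?sqr_ge0//.
  exact: cmod_jacobi_mx.
suff [z [-> zM]] : exists z : R[i],
    jacobi_act u i = z + jacobi_mx i i * u i + jacobi_mx i i.+1 * u i.+1 /\
    cmod z ^+ 2 <= M ^+ 2 * cmod (u i.-1) ^+ 2.
  apply: le_trans (cmodD3 _ _ _) _.
  by rewrite -mulrA ler_wpM2l// !mulrDr !lerD.
rewrite /jacobi_act !big_ord_recr/=.
exists (\sum_(k < i) jacobi_mx i k * u k); split=> //.
case: i JM => [|i] JM /=.
  by rewrite big_ord0 Normc.normc0 expr0n/= mulr_ge0 ?sqr_ge0.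
rewrite big_ord_recr/= big1 ?add0r// => k _.
rewrite /jacobi_mx !ifF ?mul0r//; apply/negbTE; have := ltn_ord k; lia.
Qed.

Lemma jacobi_subproof (ab : bounded_jacobi) (u : ell2 R) :
  jacobi_act u \in @ell2_pred R.
Proof.
case: ab => M abM; rewrite inE; apply/square_summableP.
have /asboolP/square_summableP[N uN] : `[< square_summable u >].
  by have := ell2_valP u; rewrite inE.
exists (3 * M ^+ 2 * (2 * N + N + N)) => n.
apply: (@le_trans _ _ (\sum_(i < n) 3 * M ^+ 2 *
    (cmod (u i.-1) ^+ 2 + cmod (u i) ^+ 2 + cmod (u i.+1) ^+ 2))).
  by apply: ler_sum => i _; exact: cmod_jacobi_act.
rewrite -mulr_sumr; apply: ler_wpM2l; first by rewrite mulr_ge0 ?sqr_ge0.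
rewrite !big_split/=; apply: lerD; [apply: lerD|]; last 2 first.
- exact: uN.
- apply: le_trans (uN n.+1); rewrite big_ord_recl/= lerDr; exact: sqr_ge0.
- case: n => [|n].
    by rewrite big_ord0 mulr_ge0//; apply: le_trans (uN 0); rewrite big_ord0.
  rewrite big_ord_recl/= mulr_natl mulr2n lerD//; last exact: uN.
  by apply: le_trans (uN 1); rewrite big_ord_recl big_ord0 addr0.
Qed.

Definition jacobi (ab : bounded_jacobi) : ell2 R -> ell2 R :=
  fun u => Ell2 (jacobi_subproof ab u).

End jacobi.

Section operators.
Context {R : realType}.
Implicit Types T S A P : ell2 R -> ell2 R.

Definition bounded_operator T : Prop :=
  linear T /\ exists M : R, forall u, ell2_norm (T u) <= M * ell2_norm u.

Definition is_adjoint T S : Prop := forall u v, inner (T u) v = inner u (S v).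

Definition positive_operator T : Prop := forall u, 0 <= inner (T u) u.

Definition is_sqrt T A : Prop :=
  [/\ bounded_operator A, positive_operator A & A \o A = T].

Definition is_modulus T A : Prop :=
  exists2 S, is_adjoint T S & is_sqrt (S \o T) A.

Definition orthogonal_projection P : Prop :=
  [/\ linear P, P \o P = P & is_adjoint P P].

End operators.

(* Values on non-Borel sets are irrelevant; they are asked to be projections
   only so that [spectral_measure] is nonnegative as a total function. *)
Record pvm (R : realType) := Pvm {
  pvm_fun :> set R -> ell2 R -> ell2 R ;
  pvm_projection : forall D, orthogonal_projection (pvm_fun D) ;
  pvm_set0 : pvm_fun set0 = cst 0 ;
  pvm_setT : pvm_fun setT = id ;
  pvm_setI : forall D D', measurable D -> measurable D' ->
    pvm_fun (D `&` D') = pvm_fun D \o pvm_fun D' ;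
  pvm_sigma_additive : forall (F : nat -> set R) u v,
    (forall n, measurable (F n)) -> trivIset setT F ->
    series (fun n => cRe (inner (pvm_fun (F n) u) v)) @ \oo -->
      cRe (inner (pvm_fun (\bigcup_n F n) u) v) /\
    series (fun n => cIm (inner (pvm_fun (F n) u) v)) @ \oo -->
      cIm (inner (pvm_fun (\bigcup_n F n) u) v) }.

Section spectral_measure.
Context {R : realType} (E : pvm R) (u : ell2 R).

Definition spectral_measure (D : set R) : \bar R :=
  (cRe (inner (E D u) u))%:E.

Let spectral_measure0 : spectral_measure set0 = 0%E.
Proof. by rewrite /spectral_measure pvm_set0 inner0l. Qed.

Let spectral_measure_ge0 D : (0 <= spectral_measure D)%E.
Proof.
have [_ EE Es] := pvm_projection E D.
have -> : spectral_measure D = (cRe (inner (E D u) (E D u)))%:E.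
  by rewrite /spectral_measure -Es -[E D (E D u)]/((E D \o E D) u) EE.
by rewrite lee_fin inner_ge0.
Qed.

Let spectral_measure_sigma_additive : semi_sigma_additive spectral_measure.
Proof.
move=> F mF tF _; have [+ _] := pvm_sigma_additive E u u mF tF.
move=> Fcvg; apply: cvg_EFin; first by apply: nearW => n; rewrite sumEFin.
rewrite [X in X @ _ --> _](_ : _ =
  series (fun n => cRe (inner (E (F n) u) u)))//.
by apply/funext => n; rewrite /= sumEFin.
Qed.

HB.instance Definition _ := isMeasure.Build _ _ _ spectral_measure
  spectral_measure0 spectral_measure_ge0 spectral_measure_sigma_additive.

End spectral_measure.

Definition complex_integrable (R : realType) (mu : {measure set R -> \bar R})
    (D : set R) (f : R -> R[i]) : Prop :=
  mu.-integrable D (EFin \o (fun s => cRe (f s))) /\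
  mu.-integrable D (EFin \o (fun s => cIm (f s))).

Definition complex_integral (R : realType) (mu : {measure set R -> \bar R})
    (D : set R) (f : R -> R[i]) : R[i] :=
  (\int[mu]_(s in D) cRe (f s)) +i* (\int[mu]_(s in D) cIm (f s)).

(* A bounded operator T on a complex Hilbert space is determined by its
   quadratic form <T u, u>, so this says T = \int f dE. *)
Definition is_spectral_integral (R : realType) (E : pvm R) (f : R -> R[i])
    (T : ell2 R -> ell2 R) : Prop :=
  bounded_operator T /\
  forall u, complex_integrable (spectral_measure E u) setT f /\
    inner (T u) u = complex_integral (spectral_measure E u) setT f.

Definition is_spectral_resolution (R : realType) (E : pvm R)
    (A : ell2 R -> ell2 R) : Prop :=
  is_spectral_integral E (fun s => s%:C) A.

(* f(A) = \int f dE, where E is the spectral resolution of A. *)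
Definition functional_calculus (R : realType) (E : pvm R) (f : R -> R[i]) :
    ell2 R -> ell2 R :=
  xget (\0 : ell2 R -> ell2 R) [set T | is_spectral_integral E f T].

Definition essentially_bounded (R : realType) (mu : {measure set R -> \bar R})
    (psi : R -> R[i]) : Prop :=
  [/\ measurable_fun setT (fun s => cRe (psi s)),
      measurable_fun setT (fun s => cIm (psi s)) &
      exists M : R, {ae mu, forall s, cmod (psi s) <= M}].

(* Main.v *)
From HB Require Import structures.
Require Import Defs.
From mathcomp Require Import all_boot all_order all_algebra.
From mathcomp Require Import complex zify ring lra.
From mathcomp Require Import all_classical all_reals all_analysis.
From mathcomp Require Import measurable_realfun.

(** Write [<u, v>] for the inner product, [|u|] for the norm, [C] for entrywise
    conjugation and [d0] for the first basis vector. The matrix [J] is complex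
    symmetric, so its adjoint is [C J C], and the antilinear operator
    [K := C J] satisfies [K K = (C J C) J = |J| ^ 2] and
    [Re <K u, v> = Re <u, K v>]: it is a symmetric square root of [|J| ^ 2],
    like [|J|] itself, and [|K u|] equals the norm of [|J| u]. Everything is
    done with the real inner product [rin u v = Re <u, v>], for which antilinear
    operators are ordinary symmetric ones.

    The main point is that [K] commutes with the spectral projections [E D] of
    [A := |J|] ([square_root_comm]). It commutes with [A ^ 2 = K ^ 2]; on the
    spectral subspace for [s <= r] the powers of [A] grow at most like those of
    [r], and on the one for [s >= r'] at least like those of [r'], so for
    [r < r'] the part of [K] leading from the first to the second is zero
    ([square_root_separates]). The growth bounds hold because spectral subspaces
    reduce [A] ([spectral_operator_comm]) and the form of [A] on the subspace of
    [D] lies between the bounds of [D].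

    Let [m D = <J (E D d0), d0>], a complex measure. As [C d0 = d0], commutation
    turns [m D] into a pairing of [E D d0] with [K (E D d0)], so Cauchy-Schwarz
    gives [|m D| <= r * nu D] whenever [D] lies in [s <= r]
    ([phase_measure_bound]). Therefore [m] has a density with respect to [nu]
    whose modulus at [s] is at most [s] ([phase_density]), and [psi] is this
    density divided by [s]. Since [f(|J|)] exists for continuous [f] and
    integrates [f] against every complex spectral measure
    ([rin_functional_calculus]), [<J f(|J|) d0, d0>] is the integral of [f]
    against [m], that is, of [s * f s * psi s] against [nu].

    Conversely any solution has [s * psi s] as the density of [m], because
    continuous functions separate bounded densities ([ae_eq_of_continuous]);
    this determines [psi] almost everywhere off [0], and the value at [0] is
    prescribed. *)

Set Implicit Arguments.
Unset Strict Implicit.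
Unset Printing Implicit Defensive.
Import Order.TTheory GRing.Theory Num.Theory.
Import numFieldNormedType.Exports.
Local Open Scope classical_set_scope.
Local Open Scope complex_scope.
Local Open Scope ring_scope.

(** * The real inner product of the sequence space *)

Section real_inner_product.
Context {R : realType}.
Implicit Types (u v w : ell2 R) (r : R).

Lemma cReM (x y : R[i]) : cRe (x * y) = cRe x * cRe y - cIm x * cIm y.
Proof. by case: x y => [a b] [c d]. Qed.

Lemma cImM (x y : R[i]) : cIm (x * y) = cRe x * cIm y + cIm x * cRe y.
Proof. by case: x y => [a b] [c d]. Qed.

Lemma cReMJ (x y : R[i]) :
  cRe (x * Num.conj y) = cRe x * cRe y + cIm x * cIm y.
Proof. case: x y => [a b] [c d] /=; ring. Qed.

Lemma cImMJ (x y : R[i]) :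
  cIm (x * Num.conj y) = cIm x * cRe y - cRe x * cIm y.
Proof. case: x y => [a b] [c d] /=; ring. Qed.

(** Real parts carry all the information, since [Im <u, v> = Re <u, i v>]
    ([cIm_inner]); over the reals an antilinear operator is just linear, and
    can be symmetric in the ordinary sense. *)
Definition rin u v : R := cRe (inner u v).

Lemma square_summable_ell2 u : cvgn (series (fun k => cmod (u k) ^+ 2)).
Proof.
have /asboolP// : `[< square_summable u >] by have := ell2_valP u; rewrite inE.
Qed.

Lemma is_cvg_inner_series (g : R[i] -> R[i] -> R) u v :
  (forall x y, `|g x y| <= cmod x ^+ 2 + cmod y ^+ 2) ->
  cvgn (series (fun k => g (u k) (v k))).
Proof.
move=> gle; apply: normed_cvg.
apply: (@series_le_cvg _ _ (fun k => cmod (u k) ^+ 2 + cmod (v k) ^+ 2)) => //.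
- by move=> k; rewrite normr_ge0.
- by move=> k; rewrite addr_ge0// sqr_ge0.
- by move=> k; exact: gle.
- have := is_cvgD (@square_summable_ell2 u) (@square_summable_ell2 v).
  by rewrite -seriesD; exact.
Qed.

(** The series converges absolutely, which turns the [limn] in the definition
    of [inner] into an actual limit. *)
Lemma cvg_rin u v :
  series (fun k => cRe (u k) * cRe (v k) + cIm (u k) * cIm (v k)) @ \oo -->
  rin u v.
Proof.
rewrite /rin /inner /=; under [X in _ --> limn (series X)]eq_fun do rewrite cReMJ.
apply: (@is_cvg_inner_series
  (fun x y => cRe x * cRe y + cIm x * cIm y)) => x y.
rewrite !sqr_cmod ler_norml; case: x y => [a b] [c d] /=.
have := sqr_ge0 (a - c); have := sqr_ge0 (b - d).
by have := sqr_ge0 (a + c); have := sqr_ge0 (b + d); nra.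
Qed.

Lemma cvg_cIm_inner u v :
  series (fun k => cIm (u k) * cRe (v k) - cRe (u k) * cIm (v k)) @ \oo -->
  cIm (inner u v).
Proof.
rewrite /inner /=; under [X in _ --> limn (series X)]eq_fun do rewrite cImMJ.
apply: (@is_cvg_inner_series
  (fun x y => cIm x * cRe y - cRe x * cIm y)) => x y.
rewrite !sqr_cmod ler_norml; case: x y => [a b] [c d] /=.
have := sqr_ge0 (a - d); have := sqr_ge0 (b - c).
by have := sqr_ge0 (a + d); have := sqr_ge0 (b + c); nra.
Qed.

Lemma rin_lim (f : nat -> R) u v (x : R) :
  (forall k, f k = cRe (u k) * cRe (v k) + cIm (u k) * cIm (v k)) ->
  series f @ \oo --> x -> rin u v = x.
Proof.
by move=> /funext -> fx; apply: (cvg_unique _ (@cvg_rin u v) fx).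
Qed.

Lemma ell2DE u v k : (u + v) k = u k + v k. Proof. by []. Qed.
Lemma ell2ZE (c : R[i]) u k : (c *: u) k = c * u k. Proof. by []. Qed.

Lemma rinC u v : rin u v = rin v u.
Proof.
apply: (rin_lim _ (@cvg_rin v u)) => k.
by rewrite mulrC [in X in _ + X]mulrC.
Qed.

Lemma rinDl u v w : rin (u + v) w = rin u w + rin v w.
Proof.
have /(_ _) := cvgD (@cvg_rin u w) (@cvg_rin v w); rewrite -seriesD; apply: rin_lim.
by move=> k; rewrite ell2DE fctE !raddfD/=; ring.
Qed.

Lemma rinZl r u v : rin (r%:C *: u) v = r * rin u v.
Proof.
have /(_ _) := cvgZl_tmp (k := r) (@cvg_rin u v).
rewrite -[X in X @ _ --> _]/(r *: series _) -seriesZ; apply: rin_lim.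
move=> k; rewrite -[LHS]/(r * (cRe (u k) * cRe (v k) + cIm (u k) * cIm (v k))).
by rewrite ell2ZE cReM cImM/=; ring.
Qed.

Lemma rinDr u v w : rin u (v + w) = rin u v + rin u w.
Proof. by rewrite rinC rinDl !(rinC u). Qed.

Lemma rinZr r u v : rin u (r%:C *: v) = r * rin u v.
Proof. by rewrite rinC rinZl rinC. Qed.

Lemma realC_opp : (- 1 : R)%:C = -1.
Proof. by rewrite rmorphN1. Qed.

Lemma rinNl u v : rin (- u) v = - rin u v.
Proof. by rewrite -scaleN1r -realC_opp rinZl mulN1r. Qed.

Lemma rinNr u v : rin u (- v) = - rin u v.
Proof. by rewrite rinC rinNl rinC. Qed.

Lemma rinBl u v w : rin (u - v) w = rin u w - rin v w.
Proof. by rewrite rinDl rinNl. Qed.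

Lemma rinBr u v w : rin u (v - w) = rin u v - rin u w.
Proof. by rewrite rinDr rinNr. Qed.

Lemma rin0l u : rin 0 u = 0.
Proof. by rewrite /rin inner0l. Qed.

Lemma rin0r u : rin u 0 = 0.
Proof. by rewrite rinC rin0l. Qed.

Lemma rin_i u v : rin ('i *: u) ('i *: v) = rin u v.
Proof.
apply: (rin_lim _ (@cvg_rin u v)) => k.
by rewrite !ell2ZE !cReM !cImM /=; ring.
Qed.

Lemma cIm_inner u v : cIm (inner u v) = rin u ('i *: v).
Proof.
apply/esym; apply: (rin_lim _ (@cvg_cIm_inner u v)) => k.
by rewrite !ell2ZE !cReM !cImM /=; ring.
Qed.

Lemma innerE u v : inner u v = rin u v +i* rin u ('i *: v).
Proof. by rewrite -cIm_inner /rin; case: (inner u v). Qed.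

Lemma scaleii u : 'i *: ('i *: u) = - u.
Proof.
by rewrite scalerA -scaleN1r; congr (_ *: _); apply/eqP; rewrite eq_complex /=;
  apply/andP; split; apply/eqP; ring.
Qed.

Lemma rin_ir u v : rin u ('i *: v) = - rin ('i *: u) v.
Proof. by rewrite -(rin_i u) scaleii rinNr. Qed.

Lemma rin_ii u : rin u ('i *: u) = 0.
Proof. by have := rin_ir u u; rewrite [X in _ = - X]rinC => ?; lra. Qed.

Lemma rin_ge0 u : 0 <= rin u u. Proof. exact: inner_ge0. Qed.

Lemma rin_eq0 u : rin u u = 0 -> u = 0.
Proof.
move=> u0; apply/val_inj/funext => k /=.
have nd : nondecreasing_seq (series (fun k => cRe (u k) * cRe (u k) +
    cIm (u k) * cIm (u k))).
  by apply/nondecreasing_series => n _ _; rewrite addr_ge0// -expr2 sqr_ge0.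
have cv := @cvg_rin u u; rewrite u0 in cv.
have := nondecreasing_cvgn_le nd (cvgP _ cv) k.+1.
rewrite (cvg_lim _ cv)// seriesSr.
have := nondecreasing_cvgn_le nd (cvgP _ cv) 0.
have : 0 <= series (fun k => cRe (u k) * cRe (u k) + cIm (u k) * cIm (u k)) k.
  by rewrite /series sumr_ge0// => n _; rewrite addr_ge0// -expr2 sqr_ge0.
rewrite /GRing.zero /=; move: (u k) => [x y] /= h _ h2.
have x0 : x ^+ 2 = 0 by nra.
have y0 : y ^+ 2 = 0 by nra.
by move/eqP: x0; move/eqP: y0; rewrite !sqrf_eq0 => /eqP -> /eqP ->.
Qed.

Lemma rin_inj u v : (forall w, rin u w = rin v w) -> u = v.
Proof.
move=> uv; apply/eqP; rewrite -subr_eq0; apply/eqP/rin_eq0.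
by rewrite rinBl uv subrr.
Qed.

(** The discriminant argument behind Cauchy-Schwarz, with a leading coefficient
    that is allowed to vanish. *)
Lemma discr_le0 (a b c : R) :
  (forall t : R, 0 <= t ^+ 2 * a + 2 * t * b + c) -> b ^+ 2 <= a * c.
Proof.
move=> h; have [a0|a0] := eqVneq a 0.
  rewrite a0 mul0r; have [->|b0] := eqVneq b 0; first by rewrite expr0n.
  (* the affine function [2 * t * b + c] takes the value [-1] here *)
  have := h (- (c + 1) / (2 * b)); rewrite a0 mulr0 add0r.
  have -> : 2 * (- (c + 1) / (2 * b)) * b = - (c + 1) by field.
  lra.
have := h (- b / a).
have a_ge0 : 0 <= a.
  rewrite leNgt; apply/negP => an.
  have [B bB B0] : exists2 B, b <= B & 0 <= B by exists `|b|; rewrite ?ler_norm.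
  have [C cC C0] : exists2 C, c <= C & 0 <= C by exists `|c|; rewrite ?ler_norm.
  (* [t >= 1] and [t * a] outweighs [2 * b] by more than [c] *)
  pose t := (2 * B + C + 1 - a) / - a.
  have tE : t * a = - (2 * B + C + 1 - a) by rewrite /t; field.
  have t1 : 1 <= t by rewrite /t ler_pdivlMr; lra.
  have := h t; rewrite expr2 -mulrA tE; nra.
have ap : 0 < a by rewrite lt_neqAle eq_sym a0.
have -> : (- b / a) ^+ 2 * a + 2 * (- b / a) * b + c = (a * c - b ^+ 2) / a.
  by field.
by rewrite pmulr_lge0 ?invr_gt0// subr_ge0.
Qed.

(** Stated for semi-definite forms: that of a positive operator may be
    degenerate. *)
Lemma form_cauchy_schwarz (A : ell2 R -> ell2 R) :
  linear A -> (forall u v, rin (A u) v = rin u (A v)) ->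
  (forall u, 0 <= rin (A u) u) ->
  forall u v, rin (A u) v ^+ 2 <= rin (A u) u * rin (A v) v.
Proof.
move=> lA sA pA u v; apply: discr_le0 => t.
have := pA (t%:C *: u + v); rewrite lA !rinDl !rinDr !rinZl !rinZr.
rewrite [rin (A v) u]sA [rin v _]rinC.
move=> ge0; apply: (le_trans ge0); rewrite le_eqVlt.
by apply/orP; left; apply/eqP; ring.
Qed.

Lemma rin_cauchy_schwarz u v : rin u v ^+ 2 <= rin u u * rin v v.
Proof. by apply: (@form_cauchy_schwarz id) => //; exact: rin_ge0. Qed.

Lemma linear_opD (T : ell2 R -> ell2 R) : linear T ->
  forall u v, T (u + v) = T u + T v.
Proof. by move=> lT u v; rewrite -[u in LHS]scale1r lT scale1r. Qed.

Lemma linear_op0 (T : ell2 R -> ell2 R) : linear T -> T 0 = 0.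
Proof.
by move=> lT; apply: (addIr (T 0)); rewrite -(linear_opD lT) !add0r.
Qed.

Lemma linear_opZ (T : ell2 R -> ell2 R) : linear T ->
  forall (c : R[i]) u, T (c *: u) = c *: T u.
Proof.
by move=> lT c u; rewrite -[_ *: u in LHS]addr0 lT (linear_op0 lT) addr0.
Qed.

Lemma linear_opN (T : ell2 R -> ell2 R) : linear T -> forall u, T (- u) = - T u.
Proof.
move=> lT u; apply: (addIr (T u)).
by rewrite -(linear_opD lT) !addNr (linear_op0 lT).
Qed.

End real_inner_product.

(** * Coordinates, and the operator of a bounded form *)

Section coordinates.
Context {R : realType}.
Implicit Types (u v w : ell2 R) (r : R).

Lemma rin_delta u k : rin u (delta k) = cRe (u k).
Proof.
apply: (@rin_lim _ (fun j => if j == k then cRe (u k) else 0)) => [j|].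
  rewrite -[delta k j]/((j == k)%:R).
  by case: eqP => [->|_] /=; ring.
apply: cvg_near_cst; exists k.+1 => // n /= kn.
by rewrite /series /= -big_mkcond /= big_nat1_eq kn.
Qed.

Lemma rin_idelta u k : rin u ('i *: delta k) = cIm (u k).
Proof. by rewrite rin_ir rin_delta ell2ZE cReM /=; ring. Qed.

Lemma conj_subproof u : (fun k => Num.conj (u k)) \in @ell2_pred R.
Proof.
rewrite inE /square_summable.
suff -> : (fun k => cmod (Num.conj (u k)) ^+ 2) = (fun k => cmod (u k) ^+ 2).
  exact: square_summable_ell2.
by apply/funext => k; rewrite !sqr_cmod; case: (u k) => x y /=; ring.
Qed.

Definition conj_ell2 u : ell2 R := Ell2 (conj_subproof u).

Lemma conj_ell2K : involutive conj_ell2.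
Proof. by move=> u; apply/val_inj/funext => k /=; rewrite conjCK. Qed.

Lemma rin_conj u v : rin (conj_ell2 u) (conj_ell2 v) = rin u v.
Proof.
apply: (rin_lim _ (@cvg_rin _ u v)) => k.
by rewrite /=; case: (u k) (v k) => [a b] [c d] /=; ring.
Qed.

Lemma conj_ell2D u v : conj_ell2 (u + v) = conj_ell2 u + conj_ell2 v.
Proof. by apply/val_inj/funext => k; exact: rmorphD. Qed.

Lemma conj_ell2_delta k : conj_ell2 (delta k) = delta k.
Proof. by apply/val_inj/funext => j /=; rewrite conjC_nat. Qed.

Lemma scale_complex (c : R[i]) u :
  c *: u = (cRe c)%:C *: u + (cIm c)%:C *: ('i *: u).
Proof.
rewrite scalerA -scalerDl; congr (_ *: _).
by case: c => x y; apply/eqP; rewrite eq_complex /=; apply/andP; split;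
  apply/eqP; ring.
Qed.

Definition trunc (c : nat -> R[i]) (n : nat) : ell2 R :=
  \sum_(k < n) c k *: delta k.

Lemma truncE c n k : trunc c n k = if (k < n)%N then c k else 0.
Proof.
elim: n => [|n IH]; first by rewrite /trunc big_ord0.
rewrite /trunc big_ord_recr ell2DE -/(trunc c n) IH ell2ZE ltnS.
rewrite -[delta n k]/((k == n)%:R).
case: (ltngtP k n) => [kn|kn|->].
- by rewrite mulr0 addr0.
- by rewrite mulr0 addr0.
- by rewrite mulr1 add0r.
Qed.

End coordinates.

Section symmetric_form.
Context {R : realType}.
Implicit Types (u v w : ell2 R) (r : R).
Variable B : ell2 R -> ell2 R -> R.
Hypothesis BC : forall u v, B u v = B v u.
Hypothesis BD : forall u v w, B (u + v) w = B u w + B v w.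
Hypothesis BZ : forall r u v, B (r%:C *: u) v = r * B u v.

Lemma form_trunc u c n : B u (trunc c n) =
  \sum_(k < n) (B u (delta k) * cRe (c k) + B u ('i *: delta k) * cIm (c k)).
Proof.
have BuD x y : B u (x + y) = B u x + B u y by rewrite BC BD !(BC u).
have BuZ r x : B u (r%:C *: x) = r * B u x by rewrite BC BZ (BC u).
elim: n => [|n IH].
  rewrite /trunc !big_ord0; have := BuZ 0 0; by rewrite scaler0 mul0r.
rewrite /trunc !big_ord_recr/= BuD -/(trunc c n) IH; congr (_ + _).
by rewrite scale_complex BuD !BuZ; ring.
Qed.

Variable M : R.
Hypothesis BM : forall u, `|B u u| <= M * rin u u.

(** A bound on the diagonal bounds the form: polarize, then optimize the
    scaling of [u]. *)
Lemma form_bounded u v : B u v ^+ 2 <= (M * rin u u) * (M * rin v v).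
Proof.
rewrite -sqrrN; apply: discr_le0 => t.
have BuD x y z : B x (y + z) = B x y + B x z by rewrite BC BD !(BC x).
have BuN x y : B x (- y) = - B x y.
  rewrite BC; have := BZ (-1) y x; rewrite realC_opp scaleN1r => ->.
  by rewrite BC mulN1r.
have BN x y : B (- x) y = - B x y by rewrite BC BuN BC.
set w := t%:C *: u.
have := BM (w + v); have := BM (w - v).
rewrite !ler_norml !BuD !BD !BuN !BN.
rewrite (BC v w) !(rinDl, rinDr, rinNl, rinNr) (rinC v w).
have -> : B w v = t * B u v by rewrite BZ.
have -> : rin w w = t ^+ 2 * rin u u by rewrite rinZl rinZr expr2 mulrA.
move=> /andP[h1 h2] /andP[h3 h4]; nra.
Qed.

End symmetric_form.

Section truncation.
Context {R : realType}.
Implicit Types (u v w : ell2 R) (r : R).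

(** Squares avoid square roots when Cauchy-Schwarz gives the rate. *)
Lemma sqr_dist_cvg (x : nat -> R) (l : R) (e : nat -> R) :
  (forall n, (l - x n) ^+ 2 <= e n) -> e @ \oo --> 0 -> x @ \oo --> l.
Proof.
move=> xe e0; apply/cvgrPdist_lt => /= eps eps0.
have eps20 : 0 < eps ^+ 2 by rewrite exprn_gt0.
move/cvgrPdist_lt: e0 => /(_ _ eps20); apply: filterS => n /=.
rewrite sub0r normrN => en.
rewrite -(@ltr_pXn2r _ 2) ?nnegrE ?normr_ge0 ?(ltW eps0)// -normrX.
rewrite ger0_norm ?sqr_ge0//; apply: le_lt_trans (xe n) _.
by apply: le_lt_trans en; exact: ler_norm.
Qed.

Lemma rin_truncr u (c : nat -> R[i]) n : rin u (trunc c n) =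
  \sum_(k < n) (cRe (u k) * cRe (c k) + cIm (u k) * cIm (c k)).
Proof.
have := (@form_trunc R rin (@rinC R) (@rinDl R) (@rinZl R) u c n) => ->.
by apply: eq_bigr => k _; rewrite rin_delta rin_idelta.
Qed.

Lemma cvg_trunc u : (fun n => rin (u - trunc u n) (u - trunc u n)) @ \oo --> 0.
Proof.
have E n : rin (u - trunc u n) (u - trunc u n) = rin u u - series (fun k =>
    cRe (u k) * cRe (u k) + cIm (u k) * cIm (u k)) n.
  rewrite !(rinBl, rinBr) [rin (trunc _ _) u]rinC !rin_truncr /series/= big_mkord.
  set S := \sum_(k < n) _; rewrite (_ : \sum_(k < n) _ = S); first by ring.
  by apply: eq_bigr => k _; rewrite truncE ltn_ord.
rewrite (_ : (fun n => _) = (fun n => rin u u - series (fun k =>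
    cRe (u k) * cRe (u k) + cIm (u k) * cIm (u k)) n)); last exact/funext.
by rewrite -(subrr (rin u u)); apply: cvgB; [exact: cvg_cst|exact: cvg_rin].
Qed.

End truncation.

Section riesz.
Context {R : realType}.
Implicit Types (u v w : ell2 R) (r : R).
Variable B : ell2 R -> ell2 R -> R.
Hypothesis BC : forall u v, B u v = B v u.
Hypothesis BD : forall u v w, B (u + v) w = B u w + B v w.
Hypothesis BZ : forall r u v, B (r%:C *: u) v = r * B u v.
Variable M : R.
Hypothesis M0 : 0 <= M.
Hypothesis BM : forall u, `|B u u| <= M * rin u u.

Let BN u v : B (- u) v = - B u v.
Proof. by have := BZ (-1) u v; rewrite realC_opp scaleN1r mulN1r. Qed.

Lemma cvg_form_trunc u v : (fun n => B u (trunc v n)) @ \oo --> B u v.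
Proof.
apply: (@sqr_dist_cvg _ _ _ (fun n => M * rin u u * (M *
  rin (v - trunc v n) (v - trunc v n)))) => [n|].
  rewrite (_ : B u v - _ = B u (v - trunc v n)).
    exact: (form_bounded BC BD BZ BM).
  by rewrite !(BC u) BD BN.
rewrite (_ : 0 = M * rin u u * (M * 0)); last by rewrite !mulr0.
by apply: cvgMl_tmp; apply: cvgMl_tmp; exact: cvg_trunc.
Qed.

Hypothesis Bi : forall u v, B ('i *: u) ('i *: v) = B u v.

(** The coordinates that an operator [T] with [rin (T u) v = B u v] must have.
    On the truncation of this sequence, form boundedness reads
    [S ^ 2 <= M ^ 2 * |u| ^ 2 * S], where [S] is the partial sum of squares. *)
Lemma riesz_subproof u :
  (fun k => B u (delta k) +i* B u ('i *: delta k)) \in @ell2_pred R.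
Proof.
rewrite inE; apply/square_summableP; exists (M ^+ 2 * rin u u) => n.
pose c k := B u (delta k) +i* B u ('i *: delta k); set S := \sum_(k < n) _.
have SE : S = B u (trunc c n).
  rewrite (form_trunc BC BD BZ); apply: eq_bigr => k _.
  by rewrite sqr_cmod /c/= !expr2.
have SR : S = rin (trunc c n) (trunc c n).
  rewrite rin_truncr; apply: eq_bigr => k _.
  by rewrite sqr_cmod truncE ltn_ord !expr2.
have S0 : 0 <= S by rewrite SR rin_ge0.
have := form_bounded BC BD BZ BM u (trunc c n); rewrite -SE -SR.
have u0 := rin_ge0 u.
have [S00|Sn0 h] := eqVneq S 0.
  by move=> _; rewrite S00 mulr_ge0// sqr_ge0.
have Sp : 0 < S by rewrite lt_neqAle eq_sym Sn0.
by rewrite -(ler_pM2r Sp); move: h; rewrite !expr2; lra.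
Qed.

Definition riesz u : ell2 R := Ell2 (riesz_subproof u).

Lemma rin_riesz u v : rin (riesz u) v = B u v.
Proof.
apply: rin_lim (fun _ => erefl) _.
rewrite (_ : series _ = (fun n => B u (trunc v n))); first exact: cvg_form_trunc.
apply/funext => n; rewrite (form_trunc BC BD BZ) /series/= big_mkord.
by apply: eq_bigr.
Qed.

Lemma riesz_linear : linear riesz.
Proof.
have Bii x y : B ('i *: x) y = - B x ('i *: y).
  by rewrite -[in RHS]Bi scaleii (BC _ (- y)) BN opprK BC.
move=> c u v; apply: rin_inj => w.
rewrite rin_riesz BD (scale_complex c u) BD !BZ rinDl rin_riesz.
rewrite (scale_complex c) rinDl !rinZl rin_riesz.
by rewrite -(opprK (rin ('i *: _) w)) -rin_ir rin_riesz -Bii.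
Qed.

Lemma riesz_bounded u : rin (riesz u) (riesz u) <= M ^+ 2 * rin u u.
Proof.
set S := rin (riesz u) (riesz u).
have SE : S = B u (riesz u) by rewrite -rin_riesz.
have := form_bounded BC BD BZ BM u (riesz u); rewrite -SE -/S.
have u0 := rin_ge0 u; have S0 : 0 <= S := rin_ge0 _.
have [->|Sn0 h] := eqVneq S 0; first by rewrite mulr_ge0// sqr_ge0.
have Sp : 0 < S by rewrite lt_neqAle eq_sym Sn0.
by rewrite -(ler_pM2r Sp); move: h; rewrite !expr2; lra.
Qed.

Lemma ell2_normE u : ell2_norm u = Num.sqrt (rin u u).
Proof. by []. Qed.

Lemma riesz_bounded_operator : bounded_operator riesz.
Proof.
split; first exact: riesz_linear.
exists M => u; rewrite !ell2_normE.
rewrite -ler_sqr ?nnegrE ?mulr_ge0 ?sqrtr_ge0//.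
by rewrite exprMn !sqr_sqrtr ?rin_ge0// riesz_bounded.
Qed.

End riesz.

(** * The antilinear square root of the squared modulus *)

Section jacobi_operator.
Context {R : realType} {a : nat -> R} {b : nat -> R[i]}.
Variable ab : bounded_jacobi a b.
Implicit Types (u v w : ell2 R) (r : R).
Let J := jacobi ab.

Lemma jacobi_mxC i j : jacobi_mx a b i j = jacobi_mx a b j i.
Proof.
rewrite /jacobi_mx eq_sym; case: eqP => [->//|_].
by case: eqP => [->|//]; rewrite ifF//; apply/negbTE; lia.
Qed.

Lemma jacobi_mx_eq0 i j : (i.+1 < j)%N -> jacobi_mx a b i j = 0.
Proof. by move=> ij; rewrite /jacobi_mx !ifF//; apply/negbTE; lia. Qed.

Lemma jacobi_linear : linear J.
Proof.
move=> c u v; apply/val_inj/funext => i.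
rewrite -[LHS]/(jacobi_act a b (c *: u + v) i).
rewrite -[RHS]/(c * jacobi_act a b u i + jacobi_act a b v i) /jacobi_act.
rewrite mulr_sumr -big_split/=; apply: eq_bigr => k _.
transitivity (jacobi_mx a b i k * (c * u k + v k)); first by [].
by rewrite mulrDr mulrCA.
Qed.

Lemma jacobi_delta k :
  J (delta k) = trunc (fun i => jacobi_mx a b k i) k.+2.
Proof.
apply/val_inj/funext => i; rewrite [RHS]truncE.
rewrite -[LHS]/(\sum_(j < i.+2) jacobi_mx a b i j * (j == k :> nat)%:R).
have [ki|ik] := ltnP k i.+2.
  rewrite (bigD1 (Ordinal ki))//= eqxx mulr1 big1 ?addr0; last first.
    by move=> j jk; rewrite (negbTE jk : (j == k :> nat) = false) mulr0.
  rewrite jacobi_mxC; case: ltnP => // ik.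
  by rewrite jacobi_mx_eq0.
rewrite ifT; last by lia.
rewrite big1; last first.
  by move=> j _; rewrite ltn_eqF ?mulr0//; have := ltn_ord j; lia.
by rewrite jacobi_mxC jacobi_mx_eq0.
Qed.

(** [J] is a symmetric matrix, so its adjoint is its entrywise conjugate. The
    columns of [J] are finite, so that it is enough to test the adjoint on the
    standard basis. *)
Lemma jacobi_adjoint (S : ell2 R -> ell2 R) : is_adjoint J S ->
  forall v, S v = conj_ell2 (J (conj_ell2 v)).
Proof.
move=> JS v; apply/val_inj/funext => k.
have Re_eq : cRe (S v k) = rin (J (delta k)) v.
  by rewrite /rin JS -/(rin _ _) rinC rin_delta.
have Im_eq : cIm (S v k) = - rin (J (delta k)) ('i *: v).
  by rewrite -cIm_inner JS cIm_inner rin_ir opprK rinC rin_ir -rin_idelta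
    -rin_ir.
rewrite -[LHS]/(S v k) -[RHS]/(Num.conj (\sum_(i < k.+2) jacobi_mx a b k i *
  Num.conj (v i))).
apply/eqP; rewrite eq_complex Re_eq Im_eq jacobi_delta !(rinC (trunc _ _)).
rewrite !rin_truncr rmorph_sum !raddf_sum.
apply/andP; split; apply/eqP; apply: eq_bigr => i _.
  by rewrite /=; case: (jacobi_mx _ _ _ _) (v i) => [x y] [z t] /=; ring.
rewrite ell2ZE cReM cImM /=.
by case: (jacobi_mx _ _ _ _) (v i) => [x y] [z t] /=; ring.
Qed.

(** The antilinear operator [K := C J], with [C] the entrywise conjugation. It
    is symmetric for [rin], and [K K = (C J C) J = J* J = |J| ^ 2]. *)
Definition conj_jacobi u : ell2 R := conj_ell2 (J u).

Lemma conj_jacobiD u v : conj_jacobi (u + v) = conj_jacobi u + conj_jacobi v.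
Proof.
by rewrite /conj_jacobi -conj_ell2D (linear_opD jacobi_linear).
Qed.

Lemma conj_jacobi_sqr (S A : ell2 R -> ell2 R) : is_adjoint J S ->
  A \o A = S \o J -> forall u, conj_jacobi (conj_jacobi u) = A (A u).
Proof.
move=> JS AA u; rewrite -[RHS]/((A \o A) u) AA /=.
by rewrite (jacobi_adjoint JS).
Qed.

Lemma conj_jacobi_sym (S : ell2 R -> ell2 R) : is_adjoint J S ->
  forall u v, rin (conj_jacobi u) v = rin u (conj_jacobi v).
Proof.
move=> JS u v; rewrite -(rin_conj (conj_jacobi u)) conj_ell2K.
by rewrite /rin JS (jacobi_adjoint JS) conj_ell2K.
Qed.

Lemma rin_jacobi_delta u k : rin (J u) (delta k) = rin (conj_jacobi u) (delta k).
Proof. by rewrite -rin_conj conj_ell2_delta. Qed.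

End jacobi_operator.

Section positive_operators.
Context {R : realType}.
Implicit Types (u v w : ell2 R).

Lemma positive_operator_ge0 (A : ell2 R -> ell2 R) : positive_operator A ->
  forall u, 0 <= rin (A u) u.
Proof. by move=> pA u; have := pA u; rewrite lecE /= => /andP[]. Qed.

(** A positive operator on a complex space is self-adjoint: its form is real,
    and polarization recovers the operator. *)
Lemma positive_operator_sym (A : ell2 R -> ell2 R) :
  linear A -> positive_operator A ->
  forall u v, rin (A u) v = rin u (A v).
Proof.
move=> lA pA.
have AD := linear_opD lA; have Ai := linear_opZ lA 'i.
have im u : rin (A u) ('i *: u) = 0.
  by rewrite -cIm_inner; have := pA u; rewrite lecE /= => /andP[/eqP].
have h u w : rin (A u) ('i *: w) = - rin (A w) ('i *: u).
  have := im (u + w); rewrite AD scalerDr !rinDl !rinDr !im; lra.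
move=> u v; have := h u ('i *: v).
by rewrite scaleii rinNr Ai rin_i (rinC u) => /oppr_inj.
Qed.

End positive_operators.

(** * Spectral measures and the spectral subspaces of a positive operator *)

Section spectral_family.
Context {R : realType} (E : pvm R).
Implicit Types (u v w : ell2 R) (D : set R).

Lemma pvm_linear D : linear (E D).
Proof. by have [] := pvm_projection E D. Qed.

Lemma pvm_sym D u v : rin (E D u) v = rin u (E D v).
Proof. by have [_ _ h] := pvm_projection E D; rewrite /rin h. Qed.

Lemma pvm_idem D u : E D (E D u) = E D u.
Proof. by have [_ h _] := pvm_projection E D; rewrite -[in RHS]h. Qed.

Lemma pvmD D u v : E D (u + v) = E D u + E D v.
Proof. exact: (linear_opD (pvm_linear D)). Qed.

Lemma pvm0 D : E D 0 = 0.
Proof. exact: (linear_op0 (pvm_linear D)). Qed.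

Lemma pvmZ D (c : R[i]) u : E D (c *: u) = c *: E D u.
Proof. exact: (linear_opZ (pvm_linear D)). Qed.

Lemma pvmN D u : E D (- u) = - E D u.
Proof. exact: (linear_opN (pvm_linear D)). Qed.

Lemma pvm_norm D u : rin (E D u) u = rin (E D u) (E D u).
Proof. by rewrite -pvm_sym pvm_idem. Qed.

Lemma pvm_capE D D' u : measurable D -> measurable D' ->
  E D (E D' u) = E (D `&` D') u.
Proof. by move=> mD mD'; rewrite pvm_setI. Qed.

Lemma spectral_measureE u D : spectral_measure E u D = (rin (E D u) u)%:E.
Proof. by []. Qed.

Lemma spectral_measure_fin_num u : fin_num_fun (spectral_measure E u).
Proof. by []. Qed.

HB.instance Definition _ u :=
  Measure_isFinite.Build _ _ _ (spectral_measure E u)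
    (spectral_measure_fin_num u).

Lemma spectral_measureT u : spectral_measure E u setT = (rin u u)%:E.
Proof. by rewrite spectral_measureE pvm_setT. Qed.

(** [E D] and [E (~` D)] project onto orthogonal subspaces, and the squared
    norms of the two parts of [u] add up to that of [u]. *)
Lemma pvm_setC D u : measurable D -> E (~` D) u = u - E D u.
Proof.
move=> mD; have mC := measurableC mD.
have h : rin (E D u) (E D u) + rin (E (~` D) u) (E (~` D) u) = rin u u.
  apply: EFin_inj; rewrite EFinD -!pvm_norm -!spectral_measureE.
  rewrite -measureU ?setICr// setUv; exact: spectral_measureT.
have o x y : rin (E D x) (E (~` D) y) = 0.
  by rewrite -pvm_sym pvm_capE// setICl pvm_set0 rin0l.
apply/esym/eqP; rewrite -subr_eq0; apply/eqP/rin_eq0.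
rewrite !(rinBl, rinBr) (rinC (E (~` D) u) (E D u)) o.
rewrite (rinC u (E D u)) (rinC u (E (~` D) u)) !pvm_norm -h; ring.
Qed.

End spectral_family.

Section integral_support.
Context {R : realType}.

Lemma Rintegral_on (mu : {measure set R -> \bar R}) (D : set R) (f : R -> R) :
  measurable D -> mu (~` D) = 0%E -> mu.-integrable setT (EFin \o f) ->
  \int[mu]_x f x = \int[mu]_(x in D) f x.
Proof.
move=> mD D0 fi; rewrite /Rintegral.
rewrite (@negligible_integral _ _ _ mu setT (~` D))//; last exact: measurableC.
by rewrite setDE setCK setTI.
Qed.

Lemma le_Rintegral_on (mu : {measure set R -> \bar R}) (D : set R)
    (f g : R -> R) :
  measurable D -> mu (~` D) = 0%E ->
  mu.-integrable setT (EFin \o f) -> mu.-integrable setT (EFin \o g) ->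
  (forall x, D x -> f x <= g x) -> \int[mu]_x f x <= \int[mu]_x g x.
Proof.
move=> mD D0 fi gi fg; rewrite !(Rintegral_on mD D0)//.
by apply: le_Rintegral => //; apply: integrableS (measurableT) _ _ _.
Qed.

Lemma geometric_le0 (y q C : R) :
  0 <= q < 1 -> (forall n, y <= q ^+ n * C) -> y <= 0.
Proof.
move=> /andP[q0 q1] h.
have cv : (fun n => q ^+ n * C) @ \oo --> 0.
  rewrite -(mul0r C); apply: cvgMr_tmp; apply: cvg_expr.
  by rewrite ger0_norm.
rewrite -(cvg_lim _ cv)//; apply: limr_ge; first exact: cvgP cv.
by apply: nearW => n; exact: h.
Qed.

End integral_support.

Section spectral_operator.
Context {R : realType} (E : pvm R) (A : ell2 R -> ell2 R).
Hypothesis EA : is_spectral_resolution E A.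
Hypothesis A_pos : positive_operator A.
Implicit Types (u v w : ell2 R) (D : set R).

Let lA : linear A. Proof. by have [[]] := EA. Qed.

Let A_sym : forall u v, rin (A u) v = rin u (A v).
Proof. exact: positive_operator_sym. Qed.

Let A_ge0 : forall u, 0 <= rin (A u) u.
Proof. exact: positive_operator_ge0. Qed.

Lemma integrable_id_spectral u :
  (spectral_measure E u).-integrable setT (EFin \o (fun s : R => s)).
Proof. by have [_ /(_ u)[[]]] := EA. Qed.

Lemma rin_spectral_operator u :
  rin (A u) u = \int[spectral_measure E u]_s s.
Proof. by have [_ /(_ u)[_]] := EA; rewrite /rin => ->. Qed.

(** Spectral subspaces reduce [A]: orthogonality of the ranges makes
    the measures of [u + v] and [u - v] coincide, so the polarized form
    vanishes. *)
Lemma spectral_operator_orth D u v : measurable D ->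
  E D u = u -> E D v = 0 -> rin (A u) v = 0.
Proof.
move=> mD Du Dv.
have o B : measurable B -> rin (E B u) v = 0.
  by move=> mB; rewrite -Du pvm_capE// setIC -pvm_capE// pvm_sym Dv rin0r.
have h : rin (A (u + v)) (u + v) = rin (A (u - v)) (u - v).
  rewrite !rin_spectral_operator /Rintegral; congr fine.
  apply: eq_measure_integral => B mB _.
  rewrite [LHS]spectral_measureE [RHS]spectral_measureE !pvmD pvmN.
  rewrite !(rinDl, rinDr, rinNl, rinNr) o// (rinC (E B v) u) -pvm_sym o//.
  by congr EFin; ring.
move: h; rewrite !(linear_opD lA) (linear_opN lA).
rewrite !(rinDl, rinDr, rinNl, rinNr) (rinC (A v) u) -A_sym; lra.
Qed.

Lemma spectral_operator_comm D u : measurable D -> A (E D u) = E D (A u).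
Proof.
move=> mD; apply: rin_inj => w.
have h x y : rin (A (E D x)) y = rin (A (E D x)) (E D y).
  apply/eqP; rewrite -subr_eq0 -rinBr; apply/eqP.
  apply: (@spectral_operator_orth D) => //; first exact: pvm_idem.
  by rewrite pvmD pvmN pvm_idem subrr.
by rewrite [LHS]h [RHS]pvm_sym [RHS]A_sym [RHS]rinC [RHS]h [RHS]A_sym [RHS]rinC.
Qed.

Let mu0 D u : measurable D -> E D u = u -> spectral_measure E u (~` D) = 0%E.
Proof. by move=> mD Du; rewrite spectral_measureE pvm_setC// Du subrr rin0l. Qed.

Let integral_cst u (r : R) : \int[spectral_measure E u]_s r = r * rin u u.
Proof. by rewrite Rintegral_cst// [X in fine X]spectral_measureT. Qed.

Let integrable_cst u (r : R) :
  (spectral_measure E u).-integrable setT (EFin \o (fun=> r)).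
Proof. exact: finite_measure_integrable_cst. Qed.

Lemma spectral_operator_le D u (r : R) : measurable D -> E D u = u ->
  (forall s, D s -> s <= r) -> rin (A u) u <= r * rin u u.
Proof.
move=> mD Du Dr; rewrite rin_spectral_operator -integral_cst.
exact: (le_Rintegral_on mD (mu0 mD Du) (integrable_id_spectral u)
  (integrable_cst u r)).
Qed.

Lemma spectral_operator_ge D u (r : R) : measurable D -> E D u = u ->
  (forall s, D s -> r <= s) -> r * rin u u <= rin (A u) u.
Proof.
move=> mD Du Dr; rewrite rin_spectral_operator -integral_cst.
exact: (le_Rintegral_on mD (mu0 mD Du) (integrable_cst u r)
  (integrable_id_spectral u)).
Qed.

(** Cauchy-Schwarz for the form of [A] upgrades a bound on the form to a bound
    on the operator. *)
Lemma spectral_operator_norm_le D u (r : R) : measurable D -> E D u = u ->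
  (forall s, D s -> s <= r) -> rin (A u) (A u) <= r ^+ 2 * rin u u.
Proof.
move=> mD Du Dr.
have DAu : E D (A u) = A u by rewrite -spectral_operator_comm// Du.
have h1 := spectral_operator_le mD Du Dr.
have h2 := spectral_operator_le mD DAu Dr.
have := form_cauchy_schwarz lA A_sym A_ge0 u (A u).
have := A_ge0 u; have := A_ge0 (A u).
have u0 := rin_ge0 u; have := rin_ge0 (A u).
set x := rin (A u) (A u) in h2 *; move=> x0 p1 p2 h.
have {}h : x ^+ 2 <= (r * rin u u) * (r * x).
  by apply: le_trans h _; apply: ler_pM.
have [->|xn0] := eqVneq x 0; first by rewrite mulr_ge0// sqr_ge0.
have xp : 0 < x by rewrite lt_neqAle eq_sym xn0.
by rewrite -(ler_pM2r xp); move: h; rewrite !expr2; lra.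
Qed.

Lemma spectral_operator_norm_ge D u (r : R) : measurable D -> E D u = u ->
  0 <= r -> (forall s, D s -> r <= s) -> r ^+ 2 * rin u u <= rin (A u) (A u).
Proof.
move=> mD Du r0 Dr; have h1 := spectral_operator_ge mD Du Dr.
have := rin_cauchy_schwarz (A u) u.
have u0 := rin_ge0 u; have := rin_ge0 (A u).
set x := rin (A u) (A u) => x0 h.
have {}h : (r * rin u u) ^+ 2 <= x * rin u u.
  by apply: le_trans h; rewrite ler_pXn2r// nnegrE ?mulr_ge0.
have [->|xn0] := eqVneq (rin u u) 0; first by rewrite mulr0.
have xp : 0 < rin u u by rewrite lt_neqAle eq_sym xn0.
by rewrite -(ler_pM2r xp); move: h; rewrite !expr2; lra.
Qed.

Lemma pvm_bigcup0 (F : nat -> set R) u : (forall n, measurable (F n)) ->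
  (forall n, E (F n) u = 0) -> E (\bigcup_n F n) u = 0.
Proof.
move=> mF F0; apply: rin_eq0; rewrite -pvm_norm; apply: EFin_inj.
rewrite -spectral_measureE; apply: measure_negligible.
  exact: bigcupT_measurable.
apply: negligible_bigcup => n; exists (F n); split => //.
by rewrite -[LHS]spectral_measureE spectral_measureE F0 rin0l.
Qed.

Lemma pvm_sub0 D D' u : measurable D -> measurable D' -> D `<=` D' ->
  E D' u = 0 -> E D u = 0.
Proof. by move=> mD mD' DD' D'0; rewrite -(setIidl DD') -pvm_capE// D'0 pvm0. Qed.

(** On the spectral subspace for [s <= - n.+1%:R^-1] the form of [A] would be
    negative. *)
Lemma pvm_neg u : E `]-oo, 0[%classic u = 0.
Proof.
have -> : `]-oo, 0[%classic = \bigcup_n `]-oo, (- n.+1%:R^-1)]%classic :> set R.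
  apply/seteqP; split => s /=; rewrite in_itv/=.
    move=> s0; have [n ns] : exists n, n.+1%:R^-1 < - s.
      have ns0 : 0 < - s by rewrite oppr_gt0.
      have := @cvg_harmonic R; move/cvgrPdist_lt => /(_ _ ns0)[n _ /(_ n)/=].
      move=> /(_ (leqnn n)); rewrite sub0r normrN => h; exists n.
      by apply: le_lt_trans h; exact: ler_norm.
    by exists n => //=; rewrite in_itv/= lerNr ltW.
  move=> [n _] /=; rewrite in_itv/= => h; apply: le_lt_trans h _.
  by rewrite oppr_lt0 invr_gt0 ltr0n.
apply: pvm_bigcup0 => n; first exact: measurable_itv.
set D := `]-oo, _]%classic; have mD : measurable D by exact: measurable_itv.
apply: rin_eq0.
have := @spectral_operator_le D (E D u) (- n.+1%:R^-1) mD (pvm_idem _ _ _).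
move=> h; have {}h := h (fun s => ltac:(by rewrite /D/= in_itv)).
have := A_ge0 (E D u); have := rin_ge0 (E D u).
have : 0 < n.+1%:R^-1 :> R by rewrite invr_gt0 ltr0n.
set z := rin (A _) _ in h *; set y := _^-1 in h *; set x := rin _ _ in h *.
by move=> y0 x0 z0; nra.
Qed.

(** A vector in the spectral subspace above [`|M| + 1] would be stretched by
    more than the norm bound [M] of [A]. *)
Lemma pvm_large : exists2 M : R, 0 <= M & forall u, E `]M, +oo[%classic u = 0.
Proof.
have [[_ [M AM]] _] := EA.
exists (`|M| + 1); first by rewrite addr_ge0.
move=> u; set D := `](`|M| + 1), +oo[%classic.
have mD : measurable D by exact: measurable_itv.
apply: rin_eq0; set v := E D u.
have h : (`|M| + 1) ^+ 2 * rin v v <= rin (A v) (A v).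
  apply: (@spectral_operator_norm_ge D) => //; first exact: pvm_idem.
  by move=> s; rewrite /D/= in_itv/= andbT => /ltW.
have h2 : rin (A v) (A v) <= M ^+ 2 * rin v v.
  have := AM v; rewrite !ell2_normE => Mv.
  rewrite -[leLHS]sqr_sqrtr ?rin_ge0// -[X in _ * X]sqr_sqrtr ?rin_ge0//.
  rewrite -exprMn ler_pXn2r// nnegrE ?sqrtr_ge0//.
  by apply: le_trans Mv; exact: sqrtr_ge0.
have := rin_ge0 v; move: h h2; rewrite -(real_normK (num_real M)).
have := normr_ge0 M; set m := `|M|; set x := rin v v; set y := rin (A v) _.
move=> m0 h h2 x0; nra.
Qed.

End spectral_operator.

(** * A symmetric square root commutes with the spectral projections *)

Lemma borel_ray_induction (R : realType) (P : set R -> Prop) :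
  P setT -> (forall x, P `]x, +oo[%classic) ->
  (forall S, measurable S -> P S -> P (~` S)) ->
  (forall F : (set R)^nat, (forall n, measurable (F n)) -> trivIset setT F ->
    (forall n, P (F n)) -> P (\bigcup_n F n)) ->
  forall D, measurable D -> P D.
Proof.
move=> PT Pray PC PU D mD.
have mE := RGenOInfty.measurableE R.
apply: (@dynkin_induction _ _ (@RGenOInfty.G R) P) => //.
- move=> _ _ [x ->] [y ->]; exists (Num.max x y).
  apply/seteqP; split => s /=; rewrite !in_itv/= !andbT gt_max.
    by move=> [-> ->].
  by move=> /andP[].
- by move=> _ [x ->]; exact: Pray.
- rewrite -[X in X D]/((RGenOInfty.G (R:=R)).-sigma.-measurable).
  by rewrite -mE.
Qed.

Section antilinear_square_root.
Context {R : realType} (E : pvm R) (A K : ell2 R -> ell2 R).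
Hypothesis EA : is_spectral_resolution E A.
Hypothesis A_pos : positive_operator A.
Hypothesis KD : forall u v, K (u + v) = K u + K v.
Hypothesis K_sym : forall u v, rin (K u) v = rin u (K v).
Hypothesis KK : forall u, K (K u) = A (A u).
Implicit Types (u v w : ell2 R) (D : set R).

Let A_sym : forall u v, rin (A u) v = rin u (A v).
Proof. by apply: positive_operator_sym => //; have [[]] := EA. Qed.

Let K0 : K 0 = 0.
Proof. by apply: (addIr (K 0)); rewrite -KD !add0r. Qed.

Let KN u : K (- u) = - K u.
Proof. by apply: (addIr (K u)); rewrite -KD !addNr K0. Qed.

Lemma norm_square_root u : rin (K u) (K u) = rin (A u) (A u).
Proof. by rewrite K_sym KK -A_sym. Qed.

Lemma square_root_comm_sqr u : K (A (A u)) = A (A (K u)).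
Proof. by rewrite -!KK. Qed.

Let norm_pvm D u : rin (E D u) (E D u) <= rin u u.
Proof.
have := rin_ge0 (u - E D u).
rewrite !(rinBl, rinBr) (rinC u (E D u)) pvm_norm; lra.
Qed.

(** On the spectral subspace for [s <= r] the norm of [A ^ 2n u] is at most
    [r ^ 2n] times that of [u]. As [K] commutes with [A ^ 2], the norm of
    [A ^ 2n (K u)] is of order [r ^ 2n] too; but [A ^ 2n] expands the subspace
    for [s >= r'] by at least [r' ^ 2n]. *)
Lemma square_root_separates (r r' : R) u : 0 <= r -> r < r' ->
  E `]-oo, r]%classic u = u -> E `[r', +oo[%classic (K u) = 0.
Proof.
move=> r0 rr' Pu.
set P := `]-oo, r]%classic in Pu *; set Q := `[r', +oo[%classic.
have mP : measurable P by exact: measurable_itv.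
have mQ : measurable Q by exact: measurable_itv.
have r'0 : 0 < r' by exact: le_lt_trans rr'.
have Pr s : P s -> s <= r by rewrite /P/= in_itv.
have Qr s : Q s -> r' <= s by rewrite /Q/= in_itv/= andbT.
have comm := spectral_operator_comm EA A_pos.
have up x : E P x = x -> rin (A x) (A x) <= r ^+ 2 * rin x x.
  by move=> Px; exact: (spectral_operator_norm_le EA A_pos mP).
have low x : E Q x = x -> r' ^+ 2 * rin x x <= rin (A x) (A x).
  by move=> Qx; apply: (spectral_operator_norm_ge EA A_pos mQ) => //; exact: ltW.
have step n : forall x, E P x = x ->
    r' ^+ 4 ^+ n * rin (E Q (K x)) (E Q (K x)) <= r ^+ 4 ^+ n * (r ^+ 2 * rin x x).
  elim: n => [|n IH] x Px.
    rewrite !expr0 !mul1r; apply: le_trans (norm_pvm _ _) _.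
    by rewrite norm_square_root; exact: up.
  have PAx : E P (A x) = A x by rewrite -comm// Px.
  have PAAx : E P (A (A x)) = A (A x) by rewrite -comm// PAx.
  set y := E Q (K x).
  have Qy : E Q y = y by rewrite /y pvm_idem.
  have QAy : E Q (A y) = A y by rewrite -comm// Qy.
  have AAy : A (A y) = E Q (K (A (A x))).
    by rewrite square_root_comm_sqr /y !comm.
  have l1 := low _ Qy; have l2 := low _ QAy.
  have u1 := up _ Px; have u2 := up _ PAx.
  have := IH _ PAAx; rewrite -AAy => ih.
  have c1 : r' ^+ 4 * rin y y <= rin (A (A y)) (A (A y)).
    apply: le_trans l2; rewrite (_ : 4 = 2 + 2)%N// exprD -mulrA.
    by apply: ler_wpM2l l1; exact: sqr_ge0.
  have c2 : rin (A (A x)) (A (A x)) <= r ^+ 4 * rin x x.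
    apply: le_trans u2 _; rewrite (_ : 4 = 2 + 2)%N// exprD -mulrA.
    by apply: ler_wpM2l u1; exact: sqr_ge0.
  rewrite !(exprSr _ n) -(mulrA (r' ^+ 4 ^+ n)) -(mulrA (r ^+ 4 ^+ n)).
  apply: (@le_trans _ _ (r' ^+ 4 ^+ n * rin (A (A y)) (A (A y)))).
    by apply: ler_wpM2l c1; rewrite !exprn_ge0// ltW.
  apply: le_trans ih _; apply: ler_wpM2l; first by rewrite !exprn_ge0.
  by rewrite mulrCA; apply: ler_wpM2l c2; exact: sqr_ge0.
set y := E Q (K u); apply: rin_eq0; apply/eqP; rewrite eq_le rin_ge0 andbT.
apply: (@geometric_le0 _ _ ((r / r') ^+ 4) (r ^+ 2 * rin u u)) => [|n].
  have q0 : 0 <= r / r' by rewrite divr_ge0// ltW.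
  by rewrite exprn_ge0//= exprn_ilt1// ltr_pdivrMr// mul1r.
have := step n _ Pu; rewrite -/y -!exprM expr_div_n.
have p : 0 < r' ^+ (4 * n) by rewrite exprn_gt0.
by move=> h; rewrite mulrAC ler_pdivlMr// mulrC.
Qed.

(** [K] maps the subspace for [s <= r] to itself, hence also its orthogonal
    complement, because [K] is symmetric. *)
Lemma square_root_comm_ray (r : R) u :
  E `]r, +oo[%classic (K u) = K (E `]r, +oo[%classic u).
Proof.
set Q := `]r, +oo[%classic.
have mQ : measurable Q by exact: measurable_itv.
have CQ : ~` Q = `]-oo, r]%classic by rewrite /Q -setCitvl setCK.
have [r0|r0] := ltP r 0.
  (* the spectrum is nonnegative: the ray carries everything *)
  have Q1 v : E Q v = v.
    apply/eqP; rewrite eq_sym -subr_eq0 -(pvm_setC _ _ mQ) CQ; apply/eqP.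
    apply: (@pvm_sub0 _ E _ `]-oo, 0[%classic); try exact: measurable_itv.
      by move=> s /=; rewrite !in_itv/= => /le_lt_trans; apply.
    exact: (pvm_neg EA A_pos).
  by rewrite !Q1.
have inv v : E (~` Q) v = v -> E Q (K v) = 0.
  rewrite CQ => Pv.
  have -> : Q = \bigcup_n `[r + n.+1%:R^-1, +oo[%classic.
    by rewrite /Q itvoyEbigcup.
  apply: pvm_bigcup0 => n; first exact: measurable_itv.
  by apply: (square_root_separates r0) => //; rewrite ltrDl invr_gt0.
have inv' v : E (~` Q) (K (E Q v)) = 0.
  apply: rin_inj => w.
  by rewrite rin0l pvm_sym K_sym pvm_sym inv ?rin0r ?pvm_idem.
have split v : v = E Q v + E (~` Q) v by rewrite pvm_setC// addrC subrK.
rewrite [u in LHS]split KD pvmD (inv (E (~` Q) u)) ?pvm_idem// addr0.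
by rewrite [RHS](split (K (E Q u))) inv' addr0.
Qed.

Lemma square_root_comm D u : measurable D -> E D (K u) = K (E D u).
Proof.
move=> mD; move: u; pose comm (B : set R) := forall u, E B (K u) = K (E B u).
apply: (@borel_ray_induction R comm) D mD.
- by move=> u; rewrite !pvm_setT.
- by move=> x u; exact: square_root_comm_ray.
- by move=> S mS cS u; rewrite !pvm_setC// cS KD KN.
- move=> F mF tF cF u; apply: rin_inj => w.
  have [+ _] := pvm_sigma_additive E (K u) w mF tF.
  have [+ _] := pvm_sigma_additive E u (K w) mF tF.
  rewrite -!/(rin _ _) -K_sym.
  rewrite [X in series X @ _ --> _ -> _](_ : _ =
    (fun n => cRe (inner (E (F n) (K u)) w))).
    by move=> h1 h2; exact: (cvg_unique _ h2 h1).
  by apply/funext => n; rewrite cF -!/(rin _ _) -K_sym.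
Qed.

End antilinear_square_root.

(** * Integrals against spectral measures *)

Section integral_combination.
Context d (T : measurableType d) (R : realType).
Variables (n : nat) (c : nat -> R) (mu : nat -> {finite_measure set T -> \bar R}).
Hypothesis mu0 : forall D, measurable D -> \sum_(i < n) c i * fine (mu i D) = 0.

Let pos (x : R) : {nonneg R} := NngNum (normr_ge0 (Num.max x 0)).

Let comb (e : nat -> R) : {measure set T -> \bar R} :=
  msum (fun i => mscale (pos (e i)) (mu i)) n.

Let posE x : (pos x)%:num = Num.max x 0.
Proof. by rewrite /= ger0_norm// le_max lexx orbT. Qed.

Let split_pos x : (pos x)%:num - (pos (- x))%:num = x.
Proof.
rewrite !posE; have [x0|/ltW x0] := leP x 0.
  by rewrite max_l ?oppr_ge0// sub0r opprK.
by rewrite max_r ?oppr_le0// subr0.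
Qed.

Let ge0_integral_combination (f : T -> \bar R) :
  (forall x, 0 <= f x)%E -> (forall i, (mu i).-integrable setT f) ->
  \sum_(i < n) c i * fine (\int[mu i]_x f x) = 0.
Proof.
move=> f0 fi; have mf := measurable_int _ (fi 0).
have fin i : (\int[mu i]_x f x)%E = (fine (\int[mu i]_x f x))%:E.
  by rewrite fineK//; exact: (integrable_fin_num measurableT (fi i)).
have intE e : (\int[comb e]_x f x)%E =
    (\sum_(i < n) (pos (e i))%:num * fine (\int[mu i]_x f x))%:E.
  rewrite ge0_integral_measure_sum// -sumEFin; apply: eq_bigr => i _.
  by rewrite ge0_integral_mscale// fin.
have : (\int[comb c]_x f x)%E = (\int[comb (fun i => (- c i)%R)]_x f x)%E.
  apply: eq_measure_integral => D mD _; rewrite /comb /= /msum /= /mscale /=.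
  have finD i : mu i D = (fine (mu i D))%:E by rewrite fineK// fin_num_measure.
  transitivity (\sum_(i < n) ((pos (c i))%:num * fine (mu i D))%:E)%E.
    by apply: eq_bigr => i _; rewrite finD.
  transitivity (\sum_(i < n) ((pos (- c i))%:num * fine (mu i D))%:E)%E; last first.
    by apply: eq_bigr => i _; rewrite finD.
  rewrite !sumEFin; congr EFin; apply/eqP; rewrite -subr_eq0 -sumrB.
  rewrite -[X in _ == X](mu0 mD); apply/eqP; apply: eq_bigr => i _.
  by rewrite -mulrBl split_pos.
rewrite !intE => -[] /eqP; rewrite -subr_eq0 -sumrB => /eqP h.
by rewrite -[RHS]h; apply: eq_bigr => i _; rewrite -mulrBl split_pos.
Qed.

(** A linear relation between finite measures, checked on measurable sets,
    passes to the integrals: move the negative coefficients to the other side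
    to get an equality of two measures. *)
Lemma integral_combination (f : T -> R) :
  (forall i, (mu i).-integrable setT (EFin \o f)) ->
  \sum_(i < n) c i * \int[mu i]_x f x = 0.
Proof.
move=> fi; have fp i := integrable_funepos measurableT (fi i).
have fn i := integrable_funeneg measurableT (fi i).
transitivity (\sum_(i < n) c i * fine (\int[mu i]_x (EFin \o f)^\+%E x) -
   \sum_(i < n) c i * fine (\int[mu i]_x (EFin \o f)^\-%E x)).
  rewrite -sumrB; apply: eq_bigr => i _; rewrite -mulrBr; congr (_ * _).
  rewrite /Rintegral integralE fineB//.
    exact: (integrable_fin_num measurableT (fp i)).
  exact: (integrable_fin_num measurableT (fn i)).
by rewrite !ge0_integral_combination ?subr0.
Qed.

End integral_combination.

Section bounded_integrable.
Context d (T : measurableType d) (R : realType).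

Lemma ae_bounded_integrable (mu : {finite_measure set T -> \bar R})
    (f : T -> R) (C : R) : measurable_fun setT f ->
  {ae mu, forall x, `|f x| <= C} -> mu.-integrable setT (EFin \o f).
Proof.
move=> mf fC; apply/integrableP; split; first exact/measurable_EFinP.
apply: (@le_lt_trans _ _ (`|C|%:E * mu setT)%E).
  apply: integral_le_bound => //; first exact/measurable_EFinP.
  by apply: filterS fC => x fx _; rewrite lee_fin (le_trans fx)// ler_norm.
by rewrite lte_mul_pinfty// ?lee_fin// ltey_eq fin_num_measure.
Qed.

End bounded_integrable.

Section spectral_form.
Context {R : realType} (E : pvm R).
Implicit Types (u v w : ell2 R) (D : set R).
Variable f : R -> R.
Hypothesis fi : forall u, (spectral_measure E u).-integrable setT (EFin \o f).
Let q u := \int[spectral_measure E u]_s f s.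

Lemma spectral_integral_combination (s : seq (R * ell2 R)) :
  (forall D, measurable D -> \sum_(p <- s) p.1 * rin (E D p.2) p.2 = 0) ->
  \sum_(p <- s) p.1 * q p.2 = 0.
Proof.
move=> h; rewrite (big_nth (0, 0)) big_mkord.
apply: (@integral_combination _ _ _ (size s) (fun i => (nth (0, 0) s i).1)
  (fun i => spectral_measure E (nth (0, 0) s i).2)) => [D mD|i]; last exact: fi.
by have := h _ mD; rewrite (big_nth (0, 0)) big_mkord.
Qed.

(** The polarization of [u |-> \int f dE_u], i.e. [Re \int f d<E u, v>]. *)
Definition spectral_form u v := (q (u + v) - q (u - v)) / 4.

Lemma spectral_formNr u v : spectral_form u (- v) = - spectral_form u v.
Proof. by rewrite /spectral_form opprK -mulNr opprB. Qed.

Let pvmB D u v : E D (u - v) = E D u - E D v.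
Proof. by rewrite pvmD pvmN. Qed.

Let polar D u v : rin (E D (u + v)) (u + v) - rin (E D (u - v)) (u - v) =
  4 * rin (E D u) v.
Proof.
rewrite pvmB pvmD !(rinDl, rinDr, rinNl, rinNr) (rinC (E D v) u) -pvm_sym; ring.
Qed.

(** The linear relations below are all inherited from the bilinearity of
    [fun u v => rin (E D u) v], one measurable set [D] at a time. *)
Let combination0 (s : seq (R * ell2 R)) :
  (forall D, measurable D -> \sum_(p <- s) p.1 * rin (E D p.2) p.2 = 0) ->
  foldr (fun p x => p.1 * q p.2 + x) 0 s = 0.
Proof. by move=> /spectral_integral_combination; rewrite unlock. Qed.

Lemma spectral_formC u v : spectral_form u v = spectral_form v u.
Proof.
have /= : foldr (fun p x => p.1 * q p.2 + x) 0 [:: (1, u - v); (-1, v - u)] = 0.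
  apply: combination0 => D mD; rewrite !big_cons !big_nil /=.
  by rewrite -(opprB u v) pvmN rinNl rinNr; ring.
rewrite /spectral_form (addrC v u).
by move: (q (u + v)) (q (u - v)) (q (v - u)) => x y z; lra.
Qed.

Lemma spectral_formD u v w :
  spectral_form (u + v) w = spectral_form u w + spectral_form v w.
Proof.
have /= : foldr (fun p x => p.1 * q p.2 + x) 0 [:: (1, u + v + w);
    (-1, u + v - w); (-1, u + w); (1, u - w); (-1, v + w); (1, v - w)] = 0.
  apply: combination0 => D mD; rewrite !big_cons !big_nil /=.
  have := polar D (u + v) w; have := polar D u w; have := polar D v w.
  rewrite (pvmD _ D u v) rinDl.
  move: (rin _ (u + v + w)) (rin _ (u + v - w)) (rin _ (u + w)) (rin _ (u - w))
    (rin _ (v + w)) (rin _ (v - w)) (rin _ w) (rin _ w) => *; lra.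
rewrite /spectral_form.
move: (q (u + v + w)) (q (u + v - w)) (q (u + w)) (q (u - w)) (q (v + w))
  (q (v - w)) => *; lra.
Qed.

Lemma spectral_formZ (r : R) u v :
  spectral_form (r%:C *: u) v = r * spectral_form u v.
Proof.
have /= : foldr (fun p x => p.1 * q p.2 + x) 0 [:: (1, r%:C *: u + v);
    (-1, r%:C *: u - v); (- r, u + v); (r, u - v)] = 0.
  apply: combination0 => D mD; rewrite !big_cons !big_nil /=.
  have := polar D (r%:C *: u) v; have := polar D u v.
  rewrite pvmZ rinZl.
  move: (rin _ (r%:C *: u + v)) (rin _ (r%:C *: u - v)) (rin _ (u + v))
    (rin _ (u - v)) (rin _ v) => x y z t k h h'; nra.
rewrite /spectral_form.
move: (q (r%:C *: u + v)) (q (r%:C *: u - v)) (q (u + v)) (q (u - v)) => *; lra.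
Qed.

Let qi w : q ('i *: w) = q w.
Proof.
have /= : foldr (fun p x => p.1 * q p.2 + x) 0 [:: (1, 'i *: w); (-1, w)] = 0.
  apply: combination0 => D mD; rewrite !big_cons !big_nil /=.
  by rewrite pvmZ rin_i; ring.
by move: (q ('i *: w)) (q w) => *; lra.
Qed.

Lemma spectral_form_i u v : spectral_form ('i *: u) ('i *: v) = spectral_form u v.
Proof. by rewrite /spectral_form -scalerDr -scalerBr !qi. Qed.

Lemma spectral_form_ii u : spectral_form u ('i *: u) = 0.
Proof.
by rewrite /spectral_form -(qi (u - _)) scalerBr scaleii opprK (addrC u) subrr mul0r.
Qed.

Lemma spectral_form_diag u : spectral_form u u = q u.
Proof.
have /= : foldr (fun p x => p.1 * q p.2 + x) 0
    [:: (1, u + u); (-1, u - u); (- 4, u)] = 0.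
  apply: combination0 => D mD; rewrite !big_cons !big_nil /=.
  have := polar D u u.
  move: (rin _ (u + u)) (rin _ (u - u)) (rin _ u) => *; lra.
rewrite /spectral_form.
by move: (q (u + u)) (q (u - u)) (q u) => *; lra.
Qed.

End spectral_form.

(** * The continuous functional calculus *)

Section complex_continuity.
Context {R : realType}.

Lemma cmod_norm (z : R[i]) : `|z| = (cmod z)%:C.
Proof. by case: z. Qed.

Lemma cmod_ge_Re (z : R[i]) : `|cRe z| <= cmod z.
Proof.
rewrite -(@ler_pXn2r _ 2) ?nnegrE ?cmod_ge0// sqr_cmod real_normK ?num_real//.
by rewrite lerDl sqr_ge0.
Qed.

Lemma cmod_ge_Im (z : R[i]) : `|cIm z| <= cmod z.
Proof.
rewrite -(@ler_pXn2r _ 2) ?nnegrE ?cmod_ge0// sqr_cmod real_normK ?num_real//.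
by rewrite lerDr sqr_ge0.
Qed.

Lemma continuous_complex_part (g : R[i] -> R) (f : R -> R[i]^o) :
  (forall x y, g (x - y) = g x - g y) -> (forall z, `|g z| <= cmod z) ->
  continuous f -> continuous (fun s => g (f s)).
Proof.
move=> gB gle cf x; apply/cvgrPdist_lt => /= e e0.
have := cf x; move/cvgrPdist_lt => /(_ e%:C).
rewrite ltcR => /(_ e0); apply: filterS => y /=.
by rewrite cmod_norm ltcR -gB => /(le_lt_trans (gle _)).
Qed.

Lemma continuous_cRe (f : R -> R[i]^o) : continuous f ->
  continuous (fun s => cRe (f s)).
Proof.
by apply: continuous_complex_part => [x y|z]; [rewrite raddfB|exact: cmod_ge_Re].
Qed.

Lemma continuous_cIm (f : R -> R[i]^o) : continuous f ->
  continuous (fun s => cIm (f s)).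
Proof.
by apply: continuous_complex_part => [x y|z]; [rewrite raddfB|exact: cmod_ge_Im].
Qed.

Lemma continuous_real_complex (f : R -> R) : continuous f ->
  continuous ((fun s => (f s)%:C) : R -> R[i]^o).
Proof.
move=> cf x; apply/cvgrPdist_lt => /= e e0.
have [er e0'] : e = (cRe e)%:C /\ 0 < cRe e.
  by move: e0; case: e => a b; rewrite ltcE /= => /andP[/eqP -> ->].
have := cf x; move/cvgrPdist_lt => /(_ _ e0'); apply: filterS => y /=.
by rewrite -rmorphB cmod_norm er ltcR /= expr0n addr0 sqrtr_sqr.
Qed.

End complex_continuity.

Section quadratic_form_ext.
Context {R : realType}.
Implicit Types (u v w : ell2 R).

(** Over the complex numbers the quadratic form determines the operator: the
    difference [D] of the two forms is antisymmetric, and so is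
    [fun u v => D u (i v)]; together these force [D] to vanish. *)
Lemma operator_ext (T T' : ell2 R -> ell2 R) : linear T -> linear T' ->
  (forall u, inner (T u) u = inner (T' u) u) -> T = T'.
Proof.
move=> lT lT' h.
have Ta := linear_opD lT; have Ta' := linear_opD lT'.
have Ti := linear_opZ lT 'i; have Ti' := linear_opZ lT' 'i.
pose D u v := rin (T u) v - rin (T' u) v.
have re u : D u u = 0 by rewrite /D /rin h subrr.
have im u : D u ('i *: u) = 0 by rewrite /D -!cIm_inner h subrr.
have re2 u v : D u v + D v u = 0.
  by have := re (u + v); have := re u; have := re v;
    rewrite /D Ta Ta' !(rinDl, rinDr); lra.
have im2 u v : D u ('i *: v) + D v ('i *: u) = 0.
  have := im (u + v); have := im u; have := im v.
  by rewrite /D Ta Ta' scalerDr !(rinDl, rinDr); lra.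
apply/funext => u; apply: rin_inj => w; apply/eqP; rewrite -subr_eq0; apply/eqP.
have Diw v : D ('i *: v) u = - D v ('i *: u).
  by rewrite /D Ti Ti' !rin_ir; ring.
have z v : D u ('i *: v) = 0.
  by have := re2 u ('i *: v); have := im2 u v; rewrite Diw; lra.
have := z (- ('i *: w)); rewrite scalerN scaleii opprK; exact.
Qed.

End quadratic_form_ext.

Section continuous_calculus.
Context {R : realType} (E : pvm R) (M : R).
Hypothesis M0 : 0 <= M.
Hypothesis EM : forall u, E (~` `[0, M]%classic) u = 0.
Implicit Types (u v w : ell2 R) (D : set R).

Let mI : measurable (`[0, M]%classic : set R). Proof. exact: measurable_itv. Qed.

Lemma spectral_measure_out u : spectral_measure E u (~` `[0, M]%classic) = 0%E.
Proof. by rewrite spectral_measureE EM rin0l. Qed.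

Lemma ae_spectral_support u :
  {ae spectral_measure E u, forall s : R, 0 <= s <= M}.
Proof.
exists (~` `[0, M]%classic); split; first exact: measurableC.
  exact: spectral_measure_out.
by apply: subsetC => s /=; rewrite in_itv.
Qed.

(** Spectral measures live on [0 <= s <= M], so that growth at infinity of
    continuous functions does not matter. *)
Lemma continuous_bounded (f : R -> R) : continuous f ->
  exists2 C, 0 <= C & forall s, 0 <= s <= M -> `|f s| <= C.
Proof.
move=> cf; have cnf : {within `[0, M], continuous (fun s => `|f s|)}.
  apply: continuous_subspaceT => x; apply: continuous_comp; first exact: cf.
  exact: norm_continuous.
have [c cI cmax] := EVT_max M0 cnf.
by exists `|f c| => // s s0; apply: cmax; rewrite in_itv.
Qed.

Lemma continuous_spectral_integrable (f : R -> R) u : continuous f ->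
  (spectral_measure E u).-integrable setT (EFin \o f).
Proof.
move=> cf; have [C C0 fC] := continuous_bounded cf.
apply: (@ae_bounded_integrable _ _ _ _ _ C); first exact: continuous_measurable_fun.
by apply: filterS (ae_spectral_support u) => s /fC.
Qed.

Lemma spectral_form_operator (f : R -> R) : continuous f ->
  exists2 T, bounded_operator T &
    forall u v, rin (T u) v = spectral_form E f u v.
Proof.
move=> cf; have fi u := continuous_spectral_integrable u cf.
have [C C0 fC] := continuous_bounded cf.
have bd u : `|spectral_form E f u u| <= C * rin u u.
  rewrite spectral_form_diag//.
  apply: (le_trans (le_normr_Rintegral measurableT (fi u))).
  have -> : C * rin u u = \int[spectral_measure E u]_s C.
    by rewrite Rintegral_cst// [X in fine X]spectral_measureT.
  apply: (le_Rintegral_on mI); first exact: spectral_measure_out.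
  - exact: (integrable_norm (fi u)).
  - exact: finite_measure_integrable_cst.
  - by move=> s /=; rewrite in_itv; exact: fC.
have Bi := spectral_form_i fi.
exists (riesz (spectral_formC fi) (spectral_formD fi) (spectral_formZ fi) bd).
  by apply: riesz_bounded_operator.
by move=> u v; rewrite rin_riesz.
Qed.

(** Both [functional_calculus E f] and the operator assembled from the forms of
    the real and imaginary parts of [f] have [\int f dE_u] as quadratic form. *)
Lemma rin_functional_calculus (f : R -> R[i]^o) : continuous f ->
  forall u v, rin (functional_calculus E f u) v =
    spectral_form E (fun s => cRe (f s)) u v -
    spectral_form E (fun s => cIm (f s)) u ('i *: v).
Proof.
move=> cf.
have cr := continuous_cRe cf; have ci := continuous_cIm cf.
have fr u := continuous_spectral_integrable u cr.
have fi u := continuous_spectral_integrable u ci.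
have [Tr bTr Trh] := spectral_form_operator cr.
have [Ti bTi Tih] := spectral_form_operator ci.
pose T u := Tr u + 'i *: Ti u.
have Th u v : rin (T u) v =
    spectral_form E (fun s => cRe (f s)) u v -
    spectral_form E (fun s => cIm (f s)) u ('i *: v).
  by rewrite /T rinDl Trh -Tih rin_ir opprK.
have specT : is_spectral_integral E f T.
  split.
    have [lr [Mr hr]] := bTr; have [li [Mi hi]] := bTi; split.
      move=> c u v; rewrite /T lr li scalerDr addrACA; congr (_ + _).
      by rewrite scalerDr !scalerA mulrC.
    exists (Num.sqrt (2 * (Mr ^+ 2 + Mi ^+ 2))) => u.
    have sq (S : ell2 R -> ell2 R) N : ell2_norm (S u) <= N * ell2_norm u ->
        rin (S u) (S u) <= N ^+ 2 * rin u u.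
      rewrite !ell2_normE => Su.
      rewrite -[leLHS]sqr_sqrtr ?rin_ge0// -[X in _ * X]sqr_sqrtr ?rin_ge0//.
      rewrite -exprMn ler_pXn2r// nnegrE ?sqrtr_ge0//.
      by apply: le_trans Su; exact: sqrtr_ge0.
    rewrite !ell2_normE -sqrtrM ?mulr_ge0 ?addr_ge0 ?sqr_ge0//.
    rewrite ler_sqrt ?mulr_ge0 ?addr_ge0 ?sqr_ge0 ?rin_ge0//.
    have := sq _ _ (hr u); have := sq _ _ (hi u).
    have := rin_ge0 (Tr u - 'i *: Ti u).
    rewrite /T !(rinDl, rinDr, rinNl, rinNr) rin_i (rinC ('i *: Ti u)).
    move: (rin (Tr u) (Tr u)) (rin (Ti u) (Ti u)) (rin (Tr u) _) => *; lra.
  move=> u; split; first by split; [exact: fr|exact: fi].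
  rewrite innerE !Th; congr (_ +i* _).
    by rewrite spectral_form_diag// spectral_form_ii// subr0.
  rewrite spectral_form_ii// sub0r scaleii -Tih rinNr opprK Tih.
  by rewrite spectral_form_diag.
have specF : is_spectral_integral E f (functional_calculus E f).
  exact: (xgetPex (\0 : ell2 R -> ell2 R) (ex_intro _ T specT)).
have [[l1 _] h1] := specF; have [[l2 _] h2] := specT.
have -> : functional_calculus E f = T.
  apply: operator_ext => // w.
  by have [_ ->] := h1 w; have [_ ->] := h2 w.
exact: Th.
Qed.

End continuous_calculus.

(** * Densities of the complex spectral measures *)

Section integral_bounds.
Context d (T : measurableType d) (R : realType).
Variable mu : {finite_measure set T -> \bar R}.

(** Test the hypothesis on the set where [k > r]. *)
Lemma ae_le_of_integral (D0 : set T) (k : T -> R) (r : R) : measurable D0 ->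
  mu.-integrable setT (EFin \o k) ->
  (forall D, measurable D -> D `<=` D0 ->
    \int[mu]_(s in D) k s <= r * fine (mu D)) ->
  {ae mu, forall s, D0 s -> k s <= r}.
Proof.
move=> mD0 ki h; pose N := D0 `&` (k @^-1` `]r, +oo[%classic).
have mk : measurable_fun setT k by apply/measurable_EFinP; exact: measurable_int ki.
have mN : measurable N.
  by apply: measurableI => //; rewrite -[X in measurable X]setTI; exact: mk.
have kN s : N s -> r < k s by move=> [_] /=; rewrite in_itv/= andbT.
have kiN : mu.-integrable N (EFin \o k) by exact: integrableS ki.
have riN : mu.-integrable N (EFin \o (fun=> r)).
  exact: finite_measure_integrable_cst.
have di : mu.-integrable N (EFin \o (fun s => k s - r)).
  by have := integrableB mN kiN riN; apply: eq_integrable.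
have d0 : \int[mu]_(s in N) `|k s - r| = 0.
  apply/eqP; rewrite eq_le; apply/andP; split; last exact: Rintegral_ge0.
  rewrite (@eq_Rintegral _ _ _ mu N (fun s => k s - r)); last first.
    by move=> s; rewrite inE => /kN; rewrite -subr_gt0 => /gtr0_norm.
  rewrite RintegralB// Rintegral_cst// subr_le0; apply: h => //.
  by move=> s [].
have : ae_eq mu N (EFin \o (fun s => k s - r)) (cst 0%E).
  apply/ae_eq_integral_abs => //; first exact: measurable_int di.
  rewrite -[LHS]fineK; last first.
    by have := integrable_fin_num mN (integrable_norm di).
  by rewrite -[fine _]/(\int[mu]_(s in N) `|k s - r|) d0.
apply: filterS => s sN D0s; rewrite leNgt; apply/negP => rk.
have Ns : N s by split => //=; rewrite in_itv/= andbT.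
by have := sN Ns => -[] /eqP; rewrite subr_eq0 gt_eqF.
Qed.

End integral_bounds.

Section spectral_density.
Context {R : realType} (E : pvm R) (u x : ell2 R) (C : R).
Hypothesis xC : forall D, measurable D -> `|rin (E D u) x| <= C * rin (E D u) u.
Implicit Types D : set R.

(* [D |-> rin (E D u) y] is nonnegative, and differs from
   [D |-> rin (E D u) x] by a multiple of the measure of [u] *)
Let y : ell2 R := C%:C *: u + x.

Local Notation nu := (spectral_measure E u).

Let xE D : rin (E D u) y = C * rin (E D u) u + rin (E D u) x.
Proof. by rewrite /y rinDr rinZr. Qed.

Let y_ge0 D : measurable D -> 0 <= rin (E D u) y.
Proof. by move=> /xC; rewrite xE ler_norml => /andP[]; lra. Qed.

(** The maximum with [0] only acts on non-measurable sets, where nonnegativity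
    is part of the interface of measures. *)
Definition shifted_measure D : \bar R := (Num.max 0 (rin (E D u) y))%:E.

Let shiftedE D : measurable D -> shifted_measure D = (rin (E D u) y)%:E.
Proof. by move=> mD; rewrite /shifted_measure max_r// y_ge0. Qed.

Let shifted0 : shifted_measure set0 = 0%E.
Proof. by rewrite shiftedE// pvm_set0 rin0l. Qed.

Let shifted_ge0 D : (0 <= shifted_measure D)%E.
Proof. by rewrite /shifted_measure lee_fin le_max lexx. Qed.

Let shifted_sigma_additive : semi_sigma_additive shifted_measure.
Proof.
move=> F mF tF mU; rewrite shiftedE//.
have [+ _] := pvm_sigma_additive E u y mF tF => Fcvg.
apply: cvg_EFin; first by apply: nearW => n; rewrite sumEFin.
rewrite [X in X @ _ --> _](_ : _ = series (fun n => rin (E (F n) u) y))//.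
apply/funext => n; rewrite /= sumEFin /series /=; apply: eq_bigr => i _.
by apply: EFin_inj; rewrite -shiftedE.
Qed.

HB.instance Definition _ := isMeasure.Build _ _ _ shifted_measure
  shifted0 shifted_ge0 shifted_sigma_additive.

Let shifted_fin : fin_num_fun shifted_measure.
Proof. by []. Qed.

HB.instance Definition _ := Measure_isFinite.Build _ _ _ shifted_measure
  shifted_fin.

Let kappa : {finite_measure set R -> \bar R} := shifted_measure.

Let kappa_dom : kappa `<< nu.
Proof.
apply/null_content_dominatesP => D mD; rewrite [kappa D]shiftedE// => D0.
have {}D0 : rin (E D u) u = 0 by apply: EFin_inj; rewrite -[RHS]D0.
have := xC mD; rewrite xE D0 mulr0 normr_le0 => /eqP ->.
by rewrite addr0.
Qed.

(** Radon-Nikodym for the signed measure [D |-> rin (E D u) x], through a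
    positive measure so that the change of variables formula applies; the last
    clause integrates [f] against it. *)
Lemma spectral_density : exists h : R -> R,
  [/\ measurable_fun setT h, {ae nu, forall s, `|h s| <= C},
      forall D, measurable D -> rin (E D u) x = \int[nu]_(s in D) h s &
      forall (f : R -> R) (B : R), measurable_fun setT f ->
        (forall v, {ae spectral_measure E v, forall s, `|f s| <= B}) ->
        spectral_form E f u x = \int[nu]_s (f s * h s)].
Proof.
pose rn := Radon_Nikodym (charge_of_finite_measure kappa) nu.
have rn_fin s : rn s = (fine (rn s))%:E.
  by rewrite fineK//; exact: Radon_Nikodym_fin_num.
have rni : nu.-integrable setT rn by exact: Radon_Nikodym_integrable.
pose g s := fine (rn s).
have gi : nu.-integrable setT (EFin \o g).
  by rewrite (_ : EFin \o g = rn)//; apply/funext => s; rewrite [RHS]rn_fin.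
pose h s := g s - C.
have Ci D : measurable D -> nu.-integrable D (EFin \o (fun=> C)).
  by move=> mD; exact: finite_measure_integrable_cst.
have hi : nu.-integrable setT (EFin \o h).
  by have := integrableB measurableT gi (Ci _ measurableT); apply: eq_integrable.
have mh : measurable_fun setT h by apply/measurable_EFinP; exact: measurable_int hi.
have hE D : measurable D -> rin (E D u) x = \int[nu]_(s in D) h s.
  move=> mD; rewrite RintegralB//; [|exact: integrableS gi|exact: Ci].
  rewrite Rintegral_cst// /Rintegral.
  rewrite (_ : (\int[nu]_(s in D) (g s)%:E)%E = kappa D).
    by rewrite [kappa D]shiftedE// -[fine (nu D)]/(rin (E D u) u) /= xE; ring.
  rewrite -[RHS]/(charge_of_finite_measure kappa D).
  rewrite (Radon_Nikodym_integral (mu := nu))//.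
  by apply: eq_integral => s _; rewrite -rn_fin.
have hC : {ae nu, forall s, `|h s| <= C}.
  have le1 : {ae nu, forall s, setT s -> h s <= C}.
    apply: ae_le_of_integral => // D mD _; rewrite -hE//.
    by apply: le_trans (ler_norm _) _; exact: xC.
  have le2 : {ae nu, forall s, setT s -> - h s <= C}.
    apply: ae_le_of_integral => //.
      by rewrite -[_ \o _]/(\- (EFin \o h))%E; exact: integrableN.
    move=> D mD _.
    have -> : \int[nu]_(s in D) (- h s) = - \int[nu]_(s in D) h s.
      rewrite -mulN1r -RintegralZl//; last exact: integrableS hi.
      by apply: eq_Rintegral => s _; rewrite mulN1r.
    rewrite -hE//; apply: le_trans (xC mD); rewrite -normrN; exact: ler_norm.
  by apply: filterS2 le1 le2 => s /(_ I) h1 /(_ I) h2; rewrite ler_norml; lra.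
exists h; split => // f B mf fB.
have fi v : (spectral_measure E v).-integrable setT (EFin \o f).
  exact: ae_bounded_integrable (fB v).
have fk : kappa.-integrable setT (EFin \o f).
  apply: (@ae_bounded_integrable _ _ _ _ _ B) => //.
  have [N [mN N0 sub]] := fB u; exists N; split => //.
  by move/null_content_dominatesP: kappa_dom; apply.
have fhi : nu.-integrable setT (EFin \o (fun s => f s * h s)).
  apply: (@ae_bounded_integrable _ _ _ _ _ (B * C)); first exact: measurable_funM.
  by apply: filterS2 (fB u) hC => s h1 h2; rewrite normrM ler_pM.
have key : \int[kappa]_s f s = \int[nu]_s (f s * h s) + C * \int[nu]_s f s.
  have Cfi : nu.-integrable setT (EFin \o (fun s => C * f s)).
    by have := integrableZl measurableT C (fi u); apply: eq_integrable.
  have := RintegralD measurableT fhi Cfi.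
  rewrite (RintegralZl _ measurableT (fi u)) => <-.
  rewrite /Rintegral -(Radon_Nikodym_change_of_variables kappa_dom)//.
  congr fine; apply: eq_integral => s _; rewrite -/rn rn_fin -EFinM /h.
  by congr EFin; rewrite -/(g s); ring.
(* [kappa] is [C] times the measure of [u] plus a quarter of the difference of
   the measures of [u + x] and [u - x] *)
pose c (i : nat) : R := nth 0 [:: 1; - C; - 4^-1; 4^-1] i.
pose m (i : nat) : {finite_measure set R -> \bar R} :=
  if i is i'.+1 then spectral_measure E (nth 0 [:: u; u + x; u - x] i') else kappa.
have := @integral_combination _ _ _ 4 c m _ f _.
rewrite !big_ord_recl !big_ord0 /c /m /=.
rewrite /spectral_form -/nu key => H.
suff : 1 * (\int[nu]_s (f s * h s) + C * \int[nu]_s f s) +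
  (- C * \int[nu]_s f s + (- 4^-1 * \int[spectral_measure E (u + x)]_s f s +
   (4^-1 * \int[spectral_measure E (u - x)]_s f s + 0))) = 0.
  move: (\int[nu]_s (f s * h s)) (\int[nu]_s f s)
    (\int[spectral_measure E (u + x)]_s f s)
    (\int[spectral_measure E (u - x)]_s f s) => *; lra.
apply: H => [D mD|[|i]]; [|exact: fk|exact: fi].
transitivity (1 * fine (kappa D) + (- C * rin (E D u) u +
    (- 4^-1 * rin (E D (u + x)) (u + x) +
     (4^-1 * rin (E D (u - x)) (u - x) + 0)))).
  by rewrite !big_ord_recl big_ord0.
rewrite [kappa D]shiftedE// xE !(pvmD, pvmN).
rewrite !(rinDl, rinDr, rinNl, rinNr) (rinC (E D x) u) -pvm_sym /=.
by move: (rin (E D u) u) (rin (E D u) x) (rin (E D x) x) => *; lra.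
Qed.

End spectral_density.

(** * Continuous functions separate bounded densities *)

Section vanishing_integrals.
Context {R : realType}.

(** A continuous approximation from below of the indicator of the ray
    [s > x]. *)
Definition ramp (x : R) (n : nat) (s : R) : R :=
  Num.min 1 (n%:R * Num.max 0 (s - x)).

Lemma ramp_continuous x n : continuous (ramp x n).
Proof.
move=> s; apply: (@continuous_min R R (cst 1)
  (fun s => n%:R * Num.max 0 (s - x))); first exact: cvg_cst.
apply: cvgMl_tmp; apply: (@continuous_max R R (cst 0) (fun s => s - x)).
  exact: cvg_cst.
by apply: cvgB; [exact: cvg_id|exact: cvg_cst].
Qed.

Lemma ramp_itv x n s : 0 <= ramp x n s <= 1.
Proof.
rewrite /ramp ge_min lexx andbT le_min ler01/=.
by rewrite mulr_ge0// le_max lexx.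
Qed.

Lemma ramp_cvg x s : ramp x n s @[n --> \oo] -->
  (\1_(`]x, +oo[%classic) s : R).
Proof.
rewrite indicE; have [sx|xs] := leP s x.
  rewrite memNset; last by rewrite /= in_itv/= andbT ltNge sx.
  rewrite (_ : (fun n => _) = cst 0); first exact: cvg_cst.
  apply/funext => n; rewrite /ramp max_l ?subr_le0// mulr0 min_r//.
rewrite mem_set; last by rewrite /= in_itv/= andbT.
apply: cvg_near_cst; have sx0 : 0 < s - x by rewrite subr_gt0.
near=> n; rewrite /ramp max_r ?ltW// min_l//.
rewrite -ler_pdivrMr// div1r; apply: ltW.
by near: n; exact: nbhs_infty_gtr.
Unshelve. all: by end_near. Qed.

Variable mu : {finite_measure set R -> \bar R}.

(** Ramps give the vanishing of the integral over every ray by dominated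
    convergence, and rays generate the Borel sets. *)
Lemma ae_eq0_of_continuous (k : R -> R) (C : R) : measurable_fun setT k ->
  {ae mu, forall s, `|k s| <= C} ->
  (forall f : R -> R, continuous f -> (forall s, 0 <= f s <= 1) ->
    \int[mu]_s (f s * k s) = 0) ->
  {ae mu, forall s, k s = 0}.
Proof.
move=> mk kC h.
have ki : mu.-integrable setT (EFin \o k) by exact: ae_bounded_integrable kC.
have kiD D : measurable D -> mu.-integrable D (EFin \o k).
  by move=> mD; exact: integrableS ki.
have fineI D : measurable D ->
    (\int[mu]_(s in D) (k s)%:E)%E = (\int[mu]_(s in D) k s)%:E.
  by move=> mD; rewrite /Rintegral fineK//; exact: integrable_fin_num (kiD _ mD).
have IT : \int[mu]_s k s = 0.
  rewrite -[RHS](h (cst 1)); last by move=> s; rewrite lexx ler01.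
    by apply: eq_Rintegral => s _; rewrite mul1r.
  by move=> s; exact: cvg_cst.
have I0 D : measurable D -> \int[mu]_(s in D) k s = 0.
  apply: (@borel_ray_induction R (fun D => \int[mu]_(s in D) k s = 0)) => //.
  - move=> x; set Q := `]x, +oo[%classic.
    have mQ : measurable Q by exact: measurable_itv.
    have mr n : measurable_fun setT (fun s => ramp x n s * k s).
      apply: measurable_funM => //.
      by apply: continuous_measurable_fun; exact: ramp_continuous.
    have m1 : measurable_fun setT (fun s => \1_Q s * k s).
      by apply: measurable_funM => //; exact: measurable_indic.
    have [|||||_ _] := @dominated_convergence _ _ _ mu setT measurableT
      (fun n s => (ramp x n s * k s)%:E) (fun s => (\1_Q s * k s)%:E)
      (fun s => `|k s|%:E).
    + by move=> n; exact/measurable_EFinP.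
    + exact/measurable_EFinP.
    + apply: aeW => s _; apply: cvg_EFin; first exact: nearW.
      by apply: cvgMr_tmp; exact: ramp_cvg.
    + exact: (integrable_norm ki).
    + apply: aeW => s n _; rewrite lee_fin normrM.
      have /andP[r0 r1] := ramp_itv x n s.
      by rewrite ger0_norm// ler_piMl.
    rewrite (_ : (fun n => _) = cst 0%E); last first.
      apply/funext => n; rewrite -[LHS]fineK.
        congr EFin; apply: (h (ramp x n)); first exact: ramp_continuous.
        exact: ramp_itv.
      apply: (@integrable_fin_num _ _ _ mu setT) => //.
      apply: (@ae_bounded_integrable _ _ _ mu _ C) => //.
      apply: filterS kC => s; apply: le_trans; rewrite normrM.
      have /andP[r0 r1] := ramp_itv x n s.
      by rewrite ger0_norm// ler_piMl.
    move=> /(cvg_unique (@ereal_hausdorff R) (cvg_cst _)) I.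
    rewrite Rintegral_mkcond /Rintegral.
    rewrite (_ : (\int[mu]_s _)%E = 0%E)// I; apply: eq_integral => s _.
    by rewrite patchE indicE; case: ifP => _; rewrite ?mul1r ?mul0r.
  - move=> S mS S0; have mC := measurableC mS.
    have := @Rintegral_setU _ _ _ mu S (~` S) k mS mC.
    rewrite setUv IT S0 add0r => <-//.
    by apply/disj_setPS; rewrite setICr.
  - move=> F mF tF F0; rewrite /Rintegral integral_bigcup//.
      by rewrite eseries0// => i _ _; rewrite fineI// F0.
    by apply: kiD; exact: bigcupT_measurable.
have le1 : {ae mu, forall s, setT s -> k s <= 0}.
  by apply: ae_le_of_integral => // D mD _; rewrite I0// mul0r.
have le2 : {ae mu, forall s, setT s -> - k s <= 0}.
  apply: ae_le_of_integral => //.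
    by have := integrableN ki; apply: eq_integrable.
  move=> D mD _; rewrite mul0r.
  have := RintegralZl (-1) mD (kiD _ mD); rewrite I0// mulr0.
  rewrite (@eq_Rintegral _ _ _ mu D (fun s => - k s)) => [->//|s _].
  by rewrite mulN1r.
apply: filterS2 le1 le2 => s /(_ I) h1 /(_ I) h2.
by apply/eqP; rewrite eq_le h1/= -oppr_le0.
Qed.

Lemma ae_eq_of_continuous (k k' : R -> R) (C : R) :
  measurable_fun setT k -> measurable_fun setT k' ->
  {ae mu, forall s, `|k s| <= C} -> {ae mu, forall s, `|k' s| <= C} ->
  (forall f : R -> R, continuous f -> (forall s, 0 <= f s <= 1) ->
    \int[mu]_s (f s * k s) = \int[mu]_s (f s * k' s)) ->
  {ae mu, forall s, k s = k' s}.
Proof.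
move=> mk mk' kC k'C h.
suff : {ae mu, forall s, k s - k' s = 0}.
  by apply: filterS => s /eqP; rewrite subr_eq0 => /eqP.
apply: (@ae_eq0_of_continuous _ (C + C)) => [||f cf f01].
- exact: measurable_funB.
- apply: filterS2 kC k'C => s h1 h2.
  by apply: le_trans (ler_normB _ _) _; exact: lerD.
have fi (g : R -> R) : measurable_fun setT g -> {ae mu, forall s, `|g s| <= C} ->
    mu.-integrable setT (EFin \o (fun s => f s * g s)).
  move=> mg gC; apply: (@ae_bounded_integrable _ _ _ mu _ C).
    by apply: measurable_funM => //; exact: continuous_measurable_fun.
  apply: filterS gC => s; apply: le_trans; rewrite normrM.
  by have /andP[f0 f1] := f01 s; rewrite ger0_norm// ler_piMl.
rewrite (@eq_Rintegral _ _ _ mu setT (fun s => f s * k s - f s * k' s)).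
  rewrite RintegralB//; [|exact: fi|exact: fi].
  by rewrite h// subrr.
by move=> s _; rewrite mulrBr.
Qed.

End vanishing_integrals.

(** * The phase function *)

Section phase.
Context {R : realType} {a : nat -> R} {b : nat -> R[i]}.
Variable ab : bounded_jacobi a b.
Let J := jacobi ab.
Variables (A S : ell2 R -> ell2 R) (E : pvm R).
Hypothesis JS : is_adjoint J S.
Hypothesis A_sqrt : is_sqrt (S \o J) A.
Hypothesis EA : is_spectral_resolution E A.
Implicit Types (u v : ell2 R) (D : set R).

Local Notation d0 := (delta 0 : ell2 R).
Local Notation w := (S d0).
Local Notation nu := (spectral_measure E d0).
Let K := conj_jacobi ab.

Let A_pos : positive_operator A. Proof. by case: A_sqrt. Qed.
Let AA : A \o A = S \o J. Proof. by case: A_sqrt. Qed.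
Let K_sym : forall u v, rin (K u) v = rin u (K v).
Proof. exact: conj_jacobi_sym JS. Qed.
Let KK u : K (K u) = A (A u). Proof. exact: (conj_jacobi_sqr JS AA). Qed.
Let K_comm D u : measurable D -> E D (K u) = K (E D u).
Proof. exact: (square_root_comm EA A_pos (conj_jacobiD ab) K_sym KK). Qed.

Lemma spectral_support :
  exists2 M : R, 0 <= M & forall u, E (~` `[0, M]%classic) u = 0.
Proof.
have [M M0 EM] := pvm_large EA A_pos; exists M => // u.
pose F (n : nat) := if n is 0 then `]-oo, 0[%classic else `]M, +oo[%classic : set R.
have mF n : measurable (F n) by case: n => [|n]; exact: measurable_itv.
apply: (@pvm_sub0 _ E _ (\bigcup_n F n)).
- by apply: measurableC; exact: measurable_itv.
- exact: bigcupT_measurable.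
- move=> s /=; rewrite in_itv/= => /negP; rewrite negb_and -!ltNge => /orP[s0|sM].
    by exists 0%N => //=; rewrite in_itv.
  by exists 1%N => //=; rewrite in_itv/= andbT.
- by apply: pvm_bigcup0 => // -[|n]; [exact: (pvm_neg EA A_pos)|exact: EM].
Qed.

(** Encodes [|m D| <= r * nu D] for the complex measure
    [m D = <J (E D d0), d0> = <E D d0, w>]: the left-hand side is a real linear
    functional of [m D], equal to [rin y w] for a complex multiple [y] of
    [E D d0]. Since [K] commutes with [E D], it is also [rin (K y) (E D d0)], and
    [|K y| = |A y| <= r |y|] on the spectral subspace of [D]. *)
Lemma phase_measure_bound D (r p q : R) : measurable D -> 0 <= r ->
  (forall s, D s -> s <= r) ->
  p * rin (E D d0) w + q * rin (E D d0) ('i *: w) <=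
  r * Num.sqrt (p ^+ 2 + q ^+ 2) * rin (E D d0) d0.
Proof.
move=> mD r0 Dr; rewrite pvm_norm; set x := E D d0.
pose y := p%:C *: x - q%:C *: ('i *: x).
have -> : p * rin x w + q * rin x ('i *: w) = rin y w.
  by rewrite rinBl !rinZl rin_ir mulrN.
have Ey : E D y = y.
  by rewrite /y pvmD pvmN !pvmZ pvm_idem.
have -> : rin y w = rin (K y) x.
  rewrite -[rin y w]/(cRe (inner y w)) -JS -/(rin _ _) rin_jacobi_delta.
  by rewrite -/(K y) -[in LHS]Ey -K_comm// pvm_sym.
have yy : rin y y = (p ^+ 2 + q ^+ 2) * rin x x.
  rewrite /y !(rinBl, rinBr) !rinZl !rinZr rin_i rin_ii (rinC ('i *: x) x) rin_ii.
  by ring.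
have Ky : rin (K y) (K y) <= r ^+ 2 * rin y y.
  rewrite (norm_square_root EA A_pos K_sym KK).
  exact: (spectral_operator_norm_le EA A_pos mD Ey Dr).
have x0 := rin_ge0 x.
set t := _ * _ * _; have t0 : 0 <= t by rewrite !mulr_ge0// sqrtr_ge0.
apply: le_trans (ler_norm _) _.
rewrite -(@ler_pXn2r _ 2) ?nnegrE// real_normK ?num_real//.
apply: le_trans (rin_cauchy_schwarz _ _) _.
rewrite /t !exprMn sqr_sqrtr ?addr_ge0 ?sqr_ge0// [rin x x ^+ 2]expr2 mulrA.
by rewrite ler_wpM2r// -mulrA -yy.
Qed.

End phase.

Section modulus.
Context {R : realType}.

(** A complex number is bounded in modulus by its real linear functionals; by
    density rational functionals and rational bounds suffice. *)
Lemma modulus_le_rat (x y s : R) : 0 <= s ->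
  (forall p q r : rat, 0 <= ratr r :> R -> s <= ratr r ->
    ratr p * x + ratr q * y <=
    ratr r * Num.sqrt ((ratr p : R) ^+ 2 + ratr q ^+ 2)) ->
  x ^+ 2 + y ^+ 2 <= s ^+ 2.
Proof.
move=> s0 h; rewrite leNgt; apply/negP => sxy.
pose m := Num.sqrt (x ^+ 2 + y ^+ 2).
have m2 : m ^+ 2 = x ^+ 2 + y ^+ 2 by rewrite sqr_sqrtr// addr_ge0 ?sqr_ge0.
have m0 : 0 <= m by exact: sqrtr_ge0.
have sm : s < m by rewrite -(@ltr_pXn2r _ 2) ?nnegrE// m2.
have [rr] := rat_in_itvoo sm; rewrite in_itv/= => /andP[sr rm].
set r : R := ratr rr in sr rm.
have mp : 0 < m by exact: le_lt_trans sm.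
pose e := (m - r) / 4.
have eE : m - r = 4 * e by rewrite /e; field.
have e0 : 0 < e by rewrite divr_gt0// subr_gt0.
(* errors of size [e] in both coefficients cost less than
   [4 * e * m = m * (m - r)] *)
have near_rat (z : R) : exists q : rat, `|ratr q - z| <= e.
  have [|q] := @rat_in_itvoo R (z - e) (z + e); first by lra.
  by rewrite in_itv/= => /andP[h1 h2]; exists q; rewrite ler_norml; lra.
have [pp] := near_rat x; have [qq] := near_rat y.
have := h pp qq rr; rewrite -/r; move: (ratr pp) (ratr qq) => p q {}h qy px.
have {}h := h (le_trans s0 (ltW sr)) (ltW sr).
have xm : `|x| <= m.
  rewrite -(@ler_pXn2r _ 2) ?nnegrE// real_normK ?num_real// m2.
  by rewrite lerDl sqr_ge0.
have ym : `|y| <= m.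
  rewrite -(@ler_pXn2r _ 2) ?nnegrE// real_normK ?num_real// m2.
  by rewrite lerDr sqr_ge0.
have dx : `|(p - x) * x| <= e * m by rewrite normrM ler_pM.
have dy : `|(q - y) * y| <= e * m by rewrite normrM ler_pM.
have ex : (p - x) ^+ 2 <= e ^+ 2.
  by rewrite -(real_normK (num_real (p - x))) ler_pXn2r// ?nnegrE ?ltW.
have ey : (q - y) ^+ 2 <= e ^+ 2.
  by rewrite -(real_normK (num_real (q - y))) ler_pXn2r// ?nnegrE ?ltW.
move: dx dy; rewrite !ler_norml => /andP[dx1 dx2] /andP[dy1 dy2].
have sq : Num.sqrt (p ^+ 2 + q ^+ 2) <= m + 2 * e.
  rewrite -(@ler_pXn2r _ 2) ?nnegrE ?sqrtr_ge0//; last by lra.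
  rewrite sqr_sqrtr ?addr_ge0 ?sqr_ge0//.
  have -> : p ^+ 2 + q ^+ 2 = m ^+ 2 + 2 * ((p - x) * x + (q - y) * y) +
      ((p - x) ^+ 2 + (q - y) ^+ 2) by rewrite m2; ring.
  have -> : (m + 2 * e) ^+ 2 = m ^+ 2 + 4 * (e * m) + 4 * e ^+ 2 by ring.
  have := sqr_ge0 e; lra.
have r0 : 0 <= r by exact: le_trans (ltW sr).
have h1 : p * x + q * y <= r * (m + 2 * e).
  by apply: le_trans h _; rewrite ler_wpM2l.
have h2 : p * x + q * y = m ^+ 2 + ((p - x) * x + (q - y) * y).
  by rewrite m2; ring.
nra.
Qed.

Lemma ae_eq_Rintegral (mu : {measure set R -> \bar R}) (f g : R -> R) :
  measurable_fun setT f -> measurable_fun setT g ->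
  {ae mu, forall s, f s = g s} -> \int[mu]_s f s = \int[mu]_s g s.
Proof.
move=> mf mg fg; rewrite /Rintegral; congr fine; apply: ae_eq_integral => //.
- exact/measurable_EFinP.
- exact/measurable_EFinP.
- by apply: filterS fg => s /= -> _.
Qed.

End modulus.

Section phase_function.
Context {R : realType} {a : nat -> R} {b : nat -> R[i]}.
Variable ab : bounded_jacobi a b.
Let J := jacobi ab.
Variables (A S : ell2 R -> ell2 R) (E : pvm R).
Hypothesis JS : is_adjoint J S.
Hypothesis A_sqrt : is_sqrt (S \o J) A.
Hypothesis EA : is_spectral_resolution E A.
Implicit Types (u v : ell2 R) (D : set R).

Local Notation d0 := (delta 0 : ell2 R).
Local Notation w := (S d0).
Local Notation nu := (spectral_measure E d0).

Variable M : R.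
Hypothesis M0 : 0 <= M.
Hypothesis EM : forall u, E (~` `[0, M]%classic) u = 0.

Let bound := phase_measure_bound JS A_sqrt EA.

Let bound_M (p q : R) D : measurable D -> p ^+ 2 + q ^+ 2 = 1 ->
  p * rin (E D d0) w + q * rin (E D d0) ('i *: w) <= M * rin (E D d0) d0.
Proof.
move=> mD pq; pose I : set R := `[0, M]%classic.
have mI : measurable I by exact: measurable_itv.
have Id : E I d0 = d0.
  by apply/eqP; rewrite eq_sym -subr_eq0 -pvm_setC// EM.
rewrite -Id pvm_capE// Id.
have := @bound (D `&` I) M p q (measurableI _ _ mD mI) M0.
rewrite pq sqrtr1 mulr1; apply => s [_].
by rewrite /I /= in_itv/= => /andP[].
Qed.

(** By [phase_measure_bound], the real functional of [h1 + i h2] with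
    coefficients [p] and [q] is at most [r * |p + i q|] almost everywhere on
    [s <= r]; countably many rational [p], [q], [r] are enough to bound the
    modulus of [h1 + i h2] at [s] by [s]. *)
Lemma phase_density : exists h1 h2 : R -> R,
  [/\ measurable_fun setT h1, measurable_fun setT h2,
      {ae nu, forall s, 0 <= s <= M /\ h1 s ^+ 2 + h2 s ^+ 2 <= s ^+ 2} &
      forall f : R -> R, continuous f ->
        spectral_form E f d0 w = \int[nu]_s (f s * h1 s) /\
        spectral_form E f d0 ('i *: w) = \int[nu]_s (f s * h2 s)].
Proof.
have b1 D : measurable D -> `|rin (E D d0) w| <= M * rin (E D d0) d0.
  move=> mD; have := @bound_M 1 0 D mD; have := @bound_M (-1) 0 D mD.
  rewrite sqrrN expr1n expr0n addr0 !mul0r !addr0 mul1r mulN1r.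
  by move=> /(_ erefl) h1 /(_ erefl) h2; rewrite ler_norml; lra.
have b2 D : measurable D -> `|rin (E D d0) ('i *: w)| <= M * rin (E D d0) d0.
  move=> mD; have := @bound_M 0 1 D mD; have := @bound_M 0 (-1) D mD.
  rewrite sqrrN expr1n expr0n add0r !mul0r !add0r mul1r mulN1r.
  by move=> /(_ erefl) h1 /(_ erefl) h2; rewrite ler_norml; lra.
have [h1 [mh1 h1M h1E h1f]] := spectral_density b1.
have [h2 [mh2 h2M h2E h2f]] := spectral_density b2.
exists h1, h2; split => //; last first.
  move=> f cf; have [B B0 fB] := continuous_bounded M0 cf.
  have mf := continuous_measurable_fun cf.
  have fae v : {ae spectral_measure E v, forall s, `|f s| <= B}.
    by apply: filterS (ae_spectral_support EM v) => s /fB.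
  by split; [exact: h1f mf fae|exact: h2f mf fae].
have h1i := ae_bounded_integrable mh1 h1M.
have h2i := ae_bounded_integrable mh2 h2M.
have lin (p q r : rat) : 0 <= ratr r :> R -> {ae nu, forall s : R, s <= ratr r ->
    ratr p * h1 s + ratr q * h2 s <=
    ratr r * Num.sqrt ((ratr p : R) ^+ 2 + ratr q ^+ 2)}.
  move=> r0.
  have pi : nu.-integrable setT (EFin \o (fun s => ratr p * h1 s)).
    by have := integrableZl measurableT (ratr p) h1i; apply: eq_integrable.
  have qi : nu.-integrable setT (EFin \o (fun s => ratr q * h2 s)).
    by have := integrableZl measurableT (ratr q) h2i; apply: eq_integrable.
  have mray : measurable (`]-oo, (ratr r : R)]%classic : set R).
    exact: measurable_itv.
  have : {ae nu, forall s : R, `]-oo, (ratr r : R)]%classic s ->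
      ratr p * h1 s + ratr q * h2 s <=
      ratr r * Num.sqrt ((ratr p : R) ^+ 2 + ratr q ^+ 2)}.
    apply: ae_le_of_integral => //.
      by have := integrableD measurableT pi qi; apply: eq_integrable.
    move=> D mD Dr.
    have DT : D `<=` setT by [].
    rewrite RintegralD//; [|exact: integrableS pi|exact: integrableS qi].
    rewrite !RintegralZl//; [|exact: integrableS h2i|exact: integrableS h1i].
    by rewrite -h1E// -h2E//; apply: bound => // s /Dr.
  by apply: filterS => s h sr; apply: h; rewrite /= in_itv.
have all_lin : {ae nu, forall s : R, forall p q r : rat, 0 <= ratr r :> R ->
    s <= ratr r -> ratr p * h1 s + ratr q * h2 s <=
    ratr r * Num.sqrt ((ratr p : R) ^+ 2 + ratr q ^+ 2)}.
  pose P (n : nat) (s : R) :=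
    if unpickle n is Some (p, q, r) then 0 <= ratr r :> R ->
      s <= ratr r -> ratr p * h1 s + ratr q * h2 s <=
      ratr r * Num.sqrt ((ratr p : R) ^+ 2 + ratr q ^+ 2) else True.
  have : {ae nu, forall s n, P n s}.
    apply: ae_foralln => n; rewrite /P.
    case: (unpickle n) => [[[p q] r]|]; last exact: aeW.
    have [r0|r0] := boolP (0 <= ratr r :> R).
      by apply: filterS (lin p q r r0) => s + _.
    exact: aeW.
  apply: filterS => s h p q r; have := h (pickle (p, q, r)).
  by rewrite /P pickleK.
apply: filterS2 all_lin (ae_spectral_support EM d0) => s h sM; split => //.
by apply: modulus_le_rat => //; case/andP: sM.
Qed.

(** The integrand of the theorem is [nu]-integrable, and the half-line carries
    [nu], so the complex integral splits into real ones over the line. *)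
Lemma complex_integral_phase (psi : R -> R[i]) (f : R -> R[i]^o) :
  measurable_fun setT (fun s => cRe (psi s)) ->
  measurable_fun setT (fun s => cIm (psi s)) ->
  {ae nu, forall s : R, 0 <= s -> `|psi s| <= 1} -> continuous f ->
  complex_integral nu `[0, +oo[ (fun s => s%:C * f s * psi s) =
  (\int[nu]_s (cRe (f s) * (s * cRe (psi s))) -
   \int[nu]_s (cIm (f s) * (s * cIm (psi s)))) +i*
  (\int[nu]_s (cRe (f s) * (s * cIm (psi s))) +
   \int[nu]_s (cIm (f s) * (s * cRe (psi s)))).
Proof.
move=> mre mim psi1 cf.
have cr := continuous_cRe cf; have ci := continuous_cIm cf.
have int (g k : R -> R) : continuous g -> measurable_fun setT k ->
    {ae nu, forall s, `|k s| <= cmod (psi s)} ->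
    nu.-integrable setT (EFin \o (fun s => g s * (s * k s))).
  move=> cg mk kpsi; have [B B0 gB] := continuous_bounded M0 cg.
  have gkB : {ae nu, forall s, `|g s * (s * k s)| <= B * (M * 1)}.
    apply: filterS3 psi1 kpsi (ae_spectral_support EM d0) => s h1 h2 sM.
    have /andP[s0 sM'] := sM; have := h1 s0; rewrite cmod_norm.
    rewrite -[1 in X in X -> _]/(1%:C) lecR => h3.
    rewrite normrM; apply: ler_pM => //; first exact: gB.
    rewrite normrM.
    by apply: ler_pM => //; [rewrite ger0_norm|exact: le_trans h3].
  apply: ae_bounded_integrable gkB.
  apply: measurable_funM; first exact: continuous_measurable_fun.
  by apply: measurable_funM.
have kre : {ae nu, forall s, `|cRe (psi s)| <= cmod (psi s)}.
  by apply: aeW => s; exact: cmod_ge_Re.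
have kim : {ae nu, forall s, `|cIm (psi s)| <= cmod (psi s)}.
  by apply: aeW => s; exact: cmod_ge_Im.
have i1 := int _ _ cr mre kre; have i2 := int _ _ ci mim kim.
have i3 := int _ _ cr mim kim; have i4 := int _ _ ci mre kre.
have mI : measurable (`[0, +oo[%classic : set R) by exact: measurable_itv.
have nuI : nu (~` `[0, +oo[%classic) = 0%E.
  rewrite spectral_measureE (@pvm_sub0 _ E _ (~` `[0, M]%classic)) ?rin0l//.
  - exact: measurableC.
  - by apply: measurableC; exact: measurable_itv.
  - by apply: subsetC => s /=; rewrite !in_itv/= andbT => /andP[].
rewrite /complex_integral; congr (_ +i* _).
- rewrite -RintegralB// (Rintegral_on mI nuI); last first.
    by have := integrableB measurableT i1 i2; apply: eq_integrable.
  apply: eq_Rintegral => s _.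
  by rewrite !(cReM, cImM) /=; ring.
- rewrite -RintegralD// (Rintegral_on mI nuI); last first.
    by have := integrableD measurableT i3 i4; apply: eq_integrable.
  apply: eq_Rintegral => s _.
  by rewrite !(cReM, cImM) /=; ring.
Qed.

End phase_function.

Section punctured_measurability.
Context {R : realType}.

Lemma measurable_fun_inv : measurable_fun setT (fun s : R => s^-1).
Proof.
rewrite -(setvU [set (0 : R)]); apply/measurable_funU => //.
- exact: measurableC.
- split; last exact: measurable_fun_set1.
  apply: open_continuous_measurable_fun.
    by rewrite openC; exact: closed_eq.
  by move=> s; rewrite inE /= => /eqP s0; exact: inv_continuous.
Qed.

Lemma measurable_fun_except0 (h : R -> R) (c : R) : measurable_fun setT h ->
  measurable_fun setT (fun s : R => if s == 0 then c else h s).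
Proof.
move=> mh; rewrite -(setvU [set (0 : R)]); apply/measurable_funU => //.
- exact: measurableC.
- split; last exact: measurable_fun_set1.
  apply: (@eq_measurable_fun _ _ _ _ (~` [set (0 : R)]) h).
    by move=> s; rewrite inE /= => /eqP/negbTE ->.
  exact: measurable_funS mh.
Qed.

End punctured_measurability.

Theorem theorem2p2 (R : realType) (a : nat -> R) (b : nat -> R[i])
    (a_gt0 : forall j, 0 < a j) (ab : bounded_jacobi a b)
    (absJ : ell2 R -> ell2 R) (absJ_modulus : is_modulus (jacobi ab) absJ)
    (E : pvm R) (E_absJ : is_spectral_resolution E absJ) :
  let nu := spectral_measure E (delta 0) in
  let solution (psi : R -> R[i]) :=
    [/\ essentially_bounded nu psi,
        psi 0 = 1,
        {ae nu, forall s : R, 0 <= s -> `|psi s| <= 1} &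
        forall f : R -> R[i]^o, continuous f ->
          inner (jacobi ab (functional_calculus E f (delta 0))) (delta 0) =
          complex_integral nu `[0, +oo[ (fun s => s%:C * f s * psi s)] in
  exists psi : R -> R[i], solution psi /\
    forall psi' : R -> R[i], solution psi' ->
      {ae nu, forall s : R, psi' s = psi s}.
Proof.
move=> nu solution; have [S JS A_sqrt] := absJ_modulus.
have [M M0 EM] := spectral_support A_sqrt E_absJ.
have [h1 [h2 [mh1 mh2 hae hf]]] := phase_density JS A_sqrt E_absJ M0 EM.
(* the density of [m] divided by [s] *)
pose psi (s : R) : R[i] :=
  if s == 0 then 1 else (h1 s * s^-1) +i* (h2 s * s^-1).
have mre : measurable_fun setT (fun s => cRe (psi s)).
  rewrite (_ : (fun s => _) = (fun s : R => if s == 0 then 1 else h1 s * s^-1)).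
    apply: measurable_fun_except0; apply: measurable_funM => //.
    exact: measurable_fun_inv.
  by apply/funext => s; rewrite /psi; case: ifP.
have mim : measurable_fun setT (fun s => cIm (psi s)).
  rewrite (_ : (fun s => _) = (fun s : R => if s == 0 then 0 else h2 s * s^-1)).
    apply: measurable_fun_except0; apply: measurable_funM => //.
    exact: measurable_fun_inv.
  by apply/funext => s; rewrite /psi; case: ifP.
have psi_le1 : {ae nu, forall s, cmod (psi s) <= 1}.
  apply: filterS hae => s [_ hs]; rewrite /psi; case: eqVneq => [|s0].
    by rewrite Normc.normc1.
  rewrite -(@ler_pXn2r _ 2) ?nnegrE ?cmod_ge0// expr1n sqr_cmod /=.
  rewrite !exprMn -mulrDl exprVn ler_pdivrMr ?mul1r//.
  by rewrite lt_neqAle sqr_ge0 andbT eq_sym sqrf_eq0.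
have psi_norm : {ae nu, forall s : R, 0 <= s -> `|psi s| <= 1}.
  apply: filterS psi_le1 => s h _.
  by rewrite cmod_norm -[leRHS]/(1%:C) lecR.
(* at [s = 0] both sides vanish, because [|h1 + i h2| <= s] *)
have psiE : {ae nu, forall s, s * cRe (psi s) = h1 s /\ s * cIm (psi s) = h2 s}.
  apply: filterS hae => s [_ hs]; rewrite /psi; case: eqVneq => [s0|s0] /=.
    move: hs; rewrite s0 expr0n /= => hs.
    have /eqP : h1 0 ^+ 2 = 0 by have := sqr_ge0 (h1 0); have := sqr_ge0 (h2 0); lra.
    have /eqP : h2 0 ^+ 2 = 0 by have := sqr_ge0 (h1 0); have := sqr_ge0 (h2 0); lra.
    by rewrite !sqrf_eq0 => /eqP -> /eqP ->; rewrite !mul0r.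
  by split; rewrite mulrC mulfVK.
have s_re : {ae nu, forall s, s * cRe (psi s) = h1 s} by apply: filterS psiE => s [].
have s_im : {ae nu, forall s, s * cIm (psi s) = h2 s} by apply: filterS psiE => s [].
have Iae (g k k' : R -> R) : continuous g -> measurable_fun setT k ->
    measurable_fun setT k' -> {ae nu, forall s, s * k s = k' s} ->
    \int[nu]_s (g s * (s * k s)) = \int[nu]_s (g s * k' s).
  move=> cg mk mk' kk'; have mg := continuous_measurable_fun cg.
  apply: ae_eq_Rintegral; last by apply: filterS kk' => s ->.
    by apply: measurable_funM => //; apply: measurable_funM.
  exact: measurable_funM.
(* [<J f(A) d0, d0> = <f(A) d0, S d0>] is the integral of [f] against [m] *)
have inner_h (f : R -> R[i]^o) : continuous f ->
    inner (jacobi ab (functional_calculus E f (delta 0))) (delta 0) =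
    (\int[nu]_s (cRe (f s) * h1 s) - \int[nu]_s (cIm (f s) * h2 s)) +i*
    (\int[nu]_s (cRe (f s) * h2 s) + \int[nu]_s (cIm (f s) * h1 s)).
  move=> cf; have cr := continuous_cRe cf; have ci := continuous_cIm cf.
  have FE := rin_functional_calculus M0 EM cf.
  rewrite JS innerE !FE scaleii spectral_formNr opprK.
  by have [-> ->] := hf _ cr; have [-> ->] := hf _ ci.
exists psi; split.
  split => //.
  - by split => //; exists 1.
  - by rewrite /psi eqxx.
  - move=> f cf; have cr := continuous_cRe cf; have ci := continuous_cIm cf.
    rewrite inner_h// (complex_integral_phase M0 EM mre mim psi_norm cf).
    by rewrite (Iae _ _ _ cr mre mh1)// (Iae _ _ _ ci mim mh2)//
      (Iae _ _ _ cr mim mh2)// (Iae _ _ _ ci mre mh1).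
move=> psi' [[mre' mim' _] psi'0 psi'_norm psi'E].
have psi'_le1 : {ae nu, forall s : R, 0 <= s -> cmod (psi' s) <= 1}.
  apply: filterS psi'_norm => s h s0; have := h s0.
  by rewrite cmod_norm -[leRHS]/(1%:C) lecR.
have eqI (f : R -> R) : continuous f ->
    \int[nu]_s (f s * (s * cRe (psi' s))) = \int[nu]_s (f s * h1 s) /\
    \int[nu]_s (f s * (s * cIm (psi' s))) = \int[nu]_s (f s * h2 s).
  move=> cf; have cfC := continuous_real_complex cf.
  have := psi'E _ cfC.
  rewrite inner_h// (complex_integral_phase M0 EM mre' mim' psi'_norm cfC) /=.
  have z (g : R -> R) : \int[nu]_s (0 * g s) = 0.
    rewrite (@eq_Rintegral _ _ _ nu setT (cst 0)) => [|s _]; last by rewrite mul0r.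
    by rewrite Rintegral_cst// mul0r.
  by rewrite !z !subr0 !addr0 => -[-> ->].
have hM (h : R -> R) : (forall s, h s ^+ 2 <= h1 s ^+ 2 + h2 s ^+ 2) ->
    {ae nu, forall s, `|h s| <= M}.
  move=> hh; apply: filterS hae => s [/andP[s0 sM] hs].
  rewrite -(@ler_pXn2r _ 2) ?nnegrE// real_normK ?num_real//.
  apply: le_trans (hh s) _; apply: le_trans hs _.
  by rewrite ler_pXn2r// nnegrE.
have psi'M (g : R[i] -> R) : (forall z, `|g z| <= cmod z) ->
    {ae nu, forall s, `|s * g (psi' s)| <= M}.
  move=> gle; apply: filterS2 hae psi'_le1 => s [/andP[s0 sM] _] h.
  rewrite normrM ger0_norm// -[leRHS]mulr1; apply: ler_pM => //.
  exact: le_trans (gle _) (h s0).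
have re_eq : {ae nu, forall s, s * cRe (psi' s) = h1 s}.
  apply: (@ae_eq_of_continuous _ _ _ _ M) => //.
  - exact: measurable_funM.
  - by apply: psi'M; exact: cmod_ge_Re.
  - by apply: hM => s; rewrite lerDl sqr_ge0.
  - by move=> f cf _; have [] := eqI _ cf.
have im_eq : {ae nu, forall s, s * cIm (psi' s) = h2 s}.
  apply: (@ae_eq_of_continuous _ _ _ _ M) => //.
  - exact: measurable_funM.
  - by apply: psi'M; exact: cmod_ge_Im.
  - by apply: hM => s; rewrite lerDr sqr_ge0.
  - by move=> f cf _; have [] := eqI _ cf.
apply: filterS3 re_eq im_eq psiE => s hre him [pre pim].
have [->|s0] := eqVneq s 0; first by rewrite psi'0 /psi eqxx.
apply/eqP; rewrite eq_complex; apply/andP; split; apply/eqP; apply: (mulfI s0).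
  by rewrite hre pre.
by rewrite him pim.
Qed.
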